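(* Let $\Gamma$ be a finite simplicial graph with vertex set $V$, and let $L\subseteq V$ be the set of principal vertices of $\Gamma$. Any free abelian subgroup of $U(A_\Gamma)$ generated by (images in $Out(A_\Gamma)$ of) $\Gamma$-Whitehead automorphisms has rank at most $M(L)$.
   Context: **Graphs and RAAGs.** $\Gamma$ is a finite simplicial graph with vertex set $V$; $A_\Gamma$ is the right-angled Artin group with generating set $V$ and relations $[v,w]=1$ whenever $v,w$ are adjacent. For a vertex $v$, $lk(v)$ is the set of vertices adjacent to $v$ and $st(v)=lk(v)\cup\{v\}$. $V^\pm=V\sqcup V^{-1}$ is the set of generators and their inverses; for $W\subseteq V$, $W^\pm$ is the set of elements of $W$ and their inverses. For $m\in V^\pm$, $lk(m),st(m)$ denote the link and star of the underlying vertex. For $m,n\in V^\pm$, $[m,n]=1$ means that $m,n$ commute in $A_\Gamma$ (the underlying vertices are equal or adjacent). **Principal vertices.** A vertex $v$ is principal if there is no vertex $w$ with $lk(v)\subsetneq lk(w)$. **Untwisted subgroup.** $U(A_\Gamma)\le Out(A_\Gamma)$ is the subgroup generated by the images of: inversions ($v\mapsto v^{-1}$, other generators fixed); graph automorphisms (induced by automorphisms of $\Gamma$); right folds $u\mapsto um$ and left folds $u\mapsto mu$ (other generators fixed), for distinct vertices with $lk(u)\subseteq lk(m)$; and partial conjugations ($v\mapsto m^{-1}vm$ for all $v\in C$, other generators fixed, where $C$ is a component of $\Gamma-st(m)$). **$\Gamma$W-subsets and $\Gamma$-Whitehead automorphisms.** For $m\in V^\pm$ consider the components $C$ of $\Gamma-lk(m)$.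 A subset $U\subset V^\pm$ is $m$-inseparable if either $C=\{u\}$ for some component $C$ and $U=\{u\}$ or $U=\{u^{-1}\}$ (this includes $u=m^{\pm1}$), or $U=C^\pm$ for a component $C$ with more than one vertex. $\mathbf I(m)$ is the collection of $m$-inseparable subsets. A $\Gamma$W-subset based at $m$ is a union $P$ of elements of $\mathbf I(m)$ with $m\in P$, $m^{-1}\notin P$; set $P^*=V^\pm\setminus lk(m)^\pm\setminus P$. The $\Gamma$-Whitehead automorphism $\phi(P,m)$ of $A_\Gamma$ is defined on $v\in V$ by: $v\mapsto vm^{-1}$ if $v\in P$, $v^{-1}\in P^*$, $v\ne m^{\pm1}$; $v\mapsto mv$ if $v^{-1}\in P$, $v\in P^*$, $v\neq m^{\pm1}$; $v\mapsto mvm^{-1}$ if $v,v^{-1}\in P$; $v\mapsto v$ otherwise. Its image in $Out(A_\Gamma)$ lies in $U(A_\Gamma)$. **$\Gamma$W-partitions.** The partition $\mathcal P=\{P\,|\,P^*\,|\,lk(m)^\pm\}$ of $V^\pm$ (unordered in $P,P^*$) is a $\Gamma$W-partition based at $m$ if $P$ is a $\Gamma$W-subset based at $m$ and both $P$ and $P^*$ have at least two elements; $P,P^*$ are its sides. It is then also based at $m^{-1}$, and we say it is based at the underlying vertex; a partition may be based at several vertices. **Compatibility.** $\Gamma$W-partitions $\mathcal P$ (based at $m$) and $\mathcal Q$ (based at $n$) are compatible if either (1) $P^\times\cap Q^\times=\emptyset$ for at least one choice of sides $P^\times\in\{P,P^*\}$, $Q^\times\in\{Q,Q^*\}$, or (2)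 $[m,n]=1$ and $st(m)\ne st(n)$. A compatible collection is a set of (distinct) pairwise compatible $\Gamma$W-partitions. For $U\subseteq V$, $M(U)$ is the largest possible size of a compatible collection of $\Gamma$W-partitions each of which is based at some $u\in U$. *)

(* Defs.v *)
From HB Require Import structures.
From mathcomp Require Import all_boot all_order all_algebra perm monoid.
From mathcomp Require Import boolp classical_sets.
Set Implicit Arguments.
Unset Strict Implicit.
Unset Printing Implicit Defensive.

Local Open Scope group_scope.
Local Open Scope quotient_scope.

Section Subgroups.
Variable G : groupType.

Definition is_subgroup (H : set G) : Prop :=
  [/\ H 1, (forall x y, H x -> H y -> H (x * y)) & (forall x, H x -> H x^-1)].

Definition generated (S : set G) : set G := smallest is_subgroup S.

Definition free_abelian_of_rank (k : nat) (H : set G) : Prop :=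
  exists f : 'rV[int]_k -> G,
    [/\ {morph f : x y / (x + y)%R >-> x * y}, injective f & range f = H].

End Subgroups.

Record aut (G : groupType) := Aut {
  aut_fun :> G -> G;
  aut_inv : G -> G;
  autM : {morph aut_fun : x y / x * y};
  autK : cancel aut_fun aut_inv;
  autVK : cancel aut_inv aut_fun }.

Section Aut.
Variable G : groupType.

(* [aut_inv] is determined by [aut_fun]. *)
Lemma aut_eqP (f g : aut G) : (forall x, f x = g x) -> f = g.
Proof.
case: f g => [f f' fM fK f'K] [g g' gM gK g'K] /= fg.
have {}fg : f = g by apply/funext.
subst g; have fg' : f' = g' by apply/funext => x; rewrite -{1}(g'K x) fK.
by subst g'; congr Aut; apply: Prop_irrelevance.
Qed.

HB.instance Definition _ := gen_eqMixin (aut G).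
HB.instance Definition _ := gen_choiceMixin (aut G).

Definition aut_one : aut G :=
  @Aut G id id (fun _ _ => erefl) (fun _ => erefl) (fun _ => erefl).

Lemma aut_mulM (f g : aut G) : {morph f \o g : x y / x * y}.
Proof. by move=> x y /=; rewrite !autM. Qed.

Definition aut_mul (f g : aut G) : aut G :=
  Aut (aut_mulM f g) (can_comp (autK f) (autK g))
    (can_comp (autVK g) (autVK f)).

Lemma aut_invM (f : aut G) : {morph aut_inv f : x y / x * y}.
Proof. by move=> x y; rewrite -{1}(autVK f x) -{1}(autVK f y) -autM autK. Qed.

Definition aut_invg (f : aut G) : aut G :=
  Aut (aut_invM f) (autVK f) (autK f).

Lemma aut_mulA : associative aut_mul.
Proof. by move=> f g h; apply: aut_eqP. Qed.
Lemma aut_mul1 : left_id aut_one aut_mul.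
Proof. by move=> f; apply: aut_eqP. Qed.
Lemma aut_mulr1 : right_id aut_one aut_mul.
Proof. by move=> f; apply: aut_eqP. Qed.
Lemma aut_mulV : left_inverse aut_one aut_invg aut_mul.
Proof. by move=> f; apply: aut_eqP => x /=; rewrite autK. Qed.
Lemma aut_mulrV : right_inverse aut_one aut_invg aut_mul.
Proof. by move=> f; apply: aut_eqP => x /=; rewrite autVK. Qed.

HB.instance Definition _ := isGroup.Build (aut G)
  aut_mulA aut_mul1 aut_mulr1 aut_mulV aut_mulrV.

Lemma aut1 (f : aut G) : f 1 = 1.
Proof. by apply: (mulgI (f 1)); rewrite -autM !mulg1. Qed.
Lemma autV (f : aut G) : {morph f : x / x^-1}.
Proof. by move=> x; apply/esym/mulg1_eq; rewrite -autM mulgV aut1. Qed.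

Definition inner_rel (f g : aut G) : bool :=
  `[< exists h : G, forall x, f x = h * g x * h^-1 >].

Lemma inner_relP (f g : aut G) :
  reflect (exists h : G, forall x, f x = h * g x * h^-1) (inner_rel f g).
Proof. exact: asboolP. Qed.

Lemma inner_rel_refl : reflexive inner_rel.
Proof.
by move=> f; apply/inner_relP; exists 1 => x; rewrite invg1 mul1g mulg1.
Qed.

Lemma inner_rel_sym : symmetric inner_rel.
Proof.
suff imp f g : inner_rel f g -> inner_rel g f.
  by move=> f g; apply/idP/idP; apply: imp.
move=> /inner_relP [h fg]; apply/inner_relP; exists h^-1 => x.
by rewrite fg invgK !mulgA mulVg mul1g mulgVK.
Qed.

Lemma inner_rel_trans : transitive inner_rel.
Proof.
move=> g f k /inner_relP [h fg] /inner_relP [l gk].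
by apply/inner_relP; exists (h * l) => x; rewrite fg gk invgM !mulgA.
Qed.

Canonical inner_equiv :=
  EquivRel inner_rel inner_rel_refl inner_rel_sym inner_rel_trans.

Definition out := {eq_quot inner_equiv}.
HB.instance Definition _ := Choice.on out.
HB.instance Definition _ := EqQuotient.on out.

Definition out_class (f : aut G) : out := \pi_out f.

Lemma out_classP (f g : aut G) :
  out_class f = out_class g <-> exists h : G, forall x, f x = h * g x * h^-1.
Proof.
split=> [/eqmodP/inner_relP //|fg].
by apply/eqmodP/inner_relP.
Qed.

Definition out_mul (a b : out) : out := out_class (repr a * repr b).
Definition out_inv (a : out) : out := out_class (repr a)^-1.

Lemma repr_out_class (f : aut G) :
  exists h : G, forall x, repr (out_class f) x = h * f x * h^-1.
Proof. by apply/out_classP; rewrite /out_class reprK. Qed.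

Lemma out_classM (f g : aut G) :
  out_class (f * g) = out_mul (out_class f) (out_class g).
Proof.
apply/esym/out_classP.
have [h fh] := repr_out_class f; have [l gl] := repr_out_class g.
exists (h * f l) => x; rewrite /= fh gl !autM autV.
by rewrite invgM !mulgA.
Qed.

Lemma out_classV (f : aut G) : out_class f^-1 = out_inv (out_class f).
Proof.
apply/esym/out_classP.
have [h fh] := repr_out_class f; exists (f^-1 h^-1) => x.
set r := repr _ in fh *.
have rI : injective r := can_inj (autK r).
apply: rI; rewrite [LHS](autVK r) fh !autM.
by rewrite (autV f) !(autVK f) invgK !mulgA mulgV mul1g mulgK.
Qed.

Lemma out_ind (P : out -> Prop) : (forall f, P (out_class f)) -> forall a, P a.
Proof. by move=> Pf a; rewrite -[a]reprK. Qed.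

Lemma out_mulA : associative out_mul.
Proof.
elim/out_ind=> f; elim/out_ind=> g; elim/out_ind=> h.
by rewrite -!out_classM mulgA.
Qed.
Lemma out_mul1 : left_id (out_class 1) out_mul.
Proof. by elim/out_ind=> f; rewrite -!out_classM mul1g. Qed.
Lemma out_mulr1 : right_id (out_class 1) out_mul.
Proof. by elim/out_ind=> f; rewrite -!out_classM mulg1. Qed.
Lemma out_mulV : left_inverse (out_class 1) out_inv out_mul.
Proof. by elim/out_ind=> f; rewrite -out_classV -out_classM mulVg. Qed.
Lemma out_mulrV : right_inverse (out_class 1) out_inv out_mul.
Proof. by elim/out_ind=> f; rewrite -out_classV -out_classM mulgV. Qed.

HB.instance Definition _ := isGroup.Build out
  out_mulA out_mul1 out_mulr1 out_mulV out_mulrV.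

End Aut.

(* A finite simplicial graph is a finite vertex type [V] with an adjacency
   relation [e], assumed symmetric and irreflexive where it matters. *)

Section Letters.
Variable V : finType.

(* [V] together with [V^-1]: [(v, false)] is [v] and [(v, true)] is [v^-1]. *)
Definition letter : finType := (V * bool)%type.
Definition pos (v : V) : letter := (v, false).
Definition linv (x : letter) : letter := (x.1, ~~ x.2).

Definition pm (W : {set V}) : {set letter} := [set x | x.1 \in W].

End Letters.

Section Raag.
Variables (V : finType) (e : rel V).

(* The congruence presenting the right-angled Artin group [raag e]. *)
Inductive word_eq : seq (letter V) -> seq (letter V) -> Prop :=
| WordRefl w : word_eq w w
| WordSym w w' : word_eq w w' -> word_eq w' w
| WordTrans w w' w'' : word_eq w w' -> word_eq w' w'' -> word_eq w w''
| WordCancel w w' x : word_eq (w ++ [:: x; linv x] ++ w') (w ++ w')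
| WordComm w w' u v : e u v ->
    word_eq (w ++ [:: pos u; pos v] ++ w') (w ++ [:: pos v; pos u] ++ w').

Definition word_rel (w w' : seq (letter V)) : bool := `[< word_eq w w' >].

Lemma word_relP w w' : reflect (word_eq w w') (word_rel w w').
Proof. exact: asboolP. Qed.

Lemma word_rel_refl : reflexive word_rel.
Proof. by move=> w; apply/word_relP/WordRefl. Qed.
Lemma word_rel_sym : symmetric word_rel.
Proof. by move=> w w'; apply/word_relP/word_relP; apply: WordSym. Qed.
Lemma word_rel_trans : transitive word_rel.
Proof. by move=> v u w /word_relP uv /word_relP /(WordTrans uv)/word_relP. Qed.

Canonical word_equiv :=
  EquivRel word_rel word_rel_refl word_rel_sym word_rel_trans.

Definition raag := {eq_quot word_equiv}.
HB.instance Definition _ := Choice.on raag.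
HB.instance Definition _ := EqQuotient.on raag.

Definition word_class (w : seq (letter V)) : raag := \pi_raag w.

Lemma word_classP w w' : word_class w = word_class w' <-> word_eq w w'.
Proof. by split=> [/eqmodP/word_relP //|ww']; apply/eqmodP/word_relP. Qed.

Definition word_inv (w : seq (letter V)) := rev (map (@linv V) w).

Definition raag_mul (a b : raag) : raag := word_class (repr a ++ repr b).
Definition raag_inv (a : raag) : raag := word_class (word_inv (repr a)).

Lemma linvK : involutive (@linv V).
Proof. by case=> v b; rewrite /linv /= negbK. Qed.

Lemma word_eq_catl u w w' : word_eq w w' -> word_eq (u ++ w) (u ++ w').
Proof.
elim=> [w1|w1 w2 _|w1 w2 w3 _ IH12 _|w1 w2 x|w1 w2 x y exy].
- exact: WordRefl.
- exact: WordSym.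
- exact: WordTrans IH12.
- by rewrite !(catA u); apply: WordCancel.
- by rewrite !(catA u w1); apply: WordComm.
Qed.

Lemma word_eq_catr u w w' : word_eq w w' -> word_eq (w ++ u) (w' ++ u).
Proof.
elim=> [w1|w1 w2 _|w1 w2 w3 _ IH12 _|w1 w2 x|w1 w2 x y exy].
- exact: WordRefl.
- exact: WordSym.
- exact: WordTrans IH12.
- by rewrite -!catA; apply: WordCancel.
- by rewrite -!catA; apply: WordComm.
Qed.

Lemma word_eq_cat u u' w w' :
  word_eq u u' -> word_eq w w' -> word_eq (u ++ w) (u' ++ w').
Proof.
move=> /(word_eq_catr w) uu' /(word_eq_catl u') ww'; exact: WordTrans uu' ww'.
Qed.

Lemma word_eq_mulV w : word_eq (w ++ word_inv w) [::].
Proof.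
elim: w => [|x w IHw]; first exact: WordRefl.
rewrite /word_inv /= rev_cons -cats1 catA.
have := word_eq_cat (WordRefl [:: x]) (word_eq_catr [:: linv x] IHw).
by move=> /WordTrans; apply; apply: (WordCancel [::] [::]).
Qed.

Lemma word_invK : involutive word_inv.
Proof.
move=> w; rewrite /word_inv map_rev revK -map_comp map_id_in // => x _.
exact: linvK.
Qed.

Lemma word_eq_Vmul w : word_eq (word_inv w ++ w) [::].
Proof. by rewrite -{2}(word_invK w); apply: word_eq_mulV. Qed.

Lemma raag_ind (P : raag -> Prop) : (forall w, P (word_class w)) -> forall a, P a.
Proof. by move=> Pw a; rewrite -[a]reprK. Qed.

Lemma repr_word_class w : word_eq (repr (word_class w)) w.
Proof. by apply/word_classP; rewrite /word_class reprK. Qed.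

Lemma word_classM w w' :
  word_class (w ++ w') = raag_mul (word_class w) (word_class w').
Proof. by apply/esym/word_classP/word_eq_cat; apply: repr_word_class. Qed.

Lemma raag_mulA : associative raag_mul.
Proof.
elim/raag_ind=> u; elim/raag_ind=> v; elim/raag_ind=> w.
by rewrite -!word_classM catA.
Qed.
Lemma raag_mul1 : left_id (word_class [::]) raag_mul.
Proof. by elim/raag_ind=> w; rewrite -word_classM. Qed.
Lemma raag_mulr1 : right_id (word_class [::]) raag_mul.
Proof. by elim/raag_ind=> w; rewrite -word_classM cats0. Qed.
Lemma raag_mulV : left_inverse (word_class [::]) raag_inv raag_mul.
Proof.
move=> a; rewrite -{2}[a]reprK -word_classM.
exact/word_classP/word_eq_Vmul.
Qed.
Lemma raag_mulrV : right_inverse (word_class [::]) raag_inv raag_mul.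
Proof.
move=> a; rewrite -{1}[a]reprK -word_classM.
exact/word_classP/word_eq_mulV.
Qed.

HB.instance Definition _ := isGroup.Build raag
  raag_mulA raag_mul1 raag_mulr1 raag_mulV raag_mulrV.

Definition lgen (x : letter V) : raag := word_class [:: x].
Definition gen (v : V) : raag := lgen (pos v).

Lemma lgenV x : lgen (linv x) = (lgen x)^-1.
Proof.
apply/esym/mulg1_eq; rewrite -[LHS]word_classM.
exact/word_classP/(WordCancel [::] [::]).
Qed.

Lemma lgenE x : lgen x = if x.2 then (gen x.1)^-1 else gen x.1.
Proof. by case: x => v [] /=; rewrite -?lgenV. Qed.

Lemma gen_comm u v : e u v -> commute (gen u) (gen v).
Proof.
move=> euv; rewrite /commute -[LHS]word_classM -[RHS]word_classM.
exact/word_classP/(WordComm [::] [::]).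
Qed.

Lemma raag_gen_ind (P : raag -> Prop) :
  P 1 -> (forall x a, P a -> P (lgen x * a)) -> forall a, P a.
Proof.
move=> P1 PM; elim/raag_ind; elim=> [//|x w IHw].
by rewrite -cat1s word_classM; apply: PM.
Qed.

Section Lift.
Variables (G : groupType) (f : V -> G).

Definition lletter (x : letter V) : G := if x.2 then (f x.1)^-1 else f x.1.
Definition raag_lift (a : raag) : G := \prod_(x <- repr a) lletter x.

Hypothesis f_comm : forall u v, e u v -> commute (f u) (f v).

Lemma raag_lift_word w : raag_lift (word_class w) = \prod_(x <- w) lletter x.
Proof.
rewrite /raag_lift; move: (repr _) (repr_word_class w) => u.
elim=> // {u w}.
- by move=> w1 w2 w3 _ -> _ ->.
- move=> w w' [v b]; rewrite !big_cat /= big_cons big_seq1.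
  by rewrite /lletter /=; case: b; rewrite /= ?mulVg ?mulgV mul1g.
- move=> w w' u v /f_comm fuv.
  by rewrite !big_cat /= !(big_cons, big_nil) !mulg1 /lletter /= fuv.
Qed.

Lemma raag_liftM : {morph raag_lift : a b / a * b}.
Proof.
elim/raag_ind=> u; elim/raag_ind=> w.
by rewrite -[X in raag_lift X]word_classM !raag_lift_word big_cat.
Qed.

Lemma raag_lift_gen v : raag_lift (gen v) = f v.
Proof. by rewrite raag_lift_word big_seq1. Qed.

End Lift.

Lemma raag_morph_eq (G : groupType) (f g : raag -> G) :
  {morph f : a b / a * b} -> {morph g : a b / a * b} ->
  (forall v, f (gen v) = g (gen v)) -> f =1 g.
Proof.
move=> fM gM fg.
have one (h : raag -> G) : {morph h : a b / a * b} -> h 1 = 1 :> G.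
  by move=> hM; apply: (mulgI (h 1)); rewrite -hM !mulg1.
have inv (h : raag -> G) : {morph h : a b / a * b} -> forall a, h a^-1 = (h a)^-1 :> G.
  by move=> hM a; apply/esym/mulg1_eq; rewrite -hM mulgV one.
apply: raag_gen_ind => [|x a IHa]; first by rewrite !one.
by rewrite fM gM IHa lgenE; case: x.2; rewrite ?inv ?fg.
Qed.

Definition lk (v : V) : {set V} := [set w | e v w].
Definition st (v : V) : {set V} := v |: lk v.

Definition principal : {set V} := [set v | ~~ [exists w, lk v \proper lk w]].

(* The connected components of the subgraph induced on [W]. *)
Definition components (W : {set V}) : {set {set V}} :=
  [set [set y in W | connect [rel a b | [&& a \in W, b \in W & e a b]] x y]
  | x in W].

Variant untwisted_gen (a : aut raag) : Prop :=
| UInversion v of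
    a (gen v) = (gen v)^-1 & (forall w, w != v -> a (gen w) = gen w)
| UGraphAut (s : {perm V}) of
    (forall v w, e (s v) (s w) = e v w) & (forall v, a (gen v) = gen (s v))
| URightFold u m of
    u != m & lk u \subset lk m & a (gen u) = gen u * gen m
    & (forall w, w != u -> a (gen w) = gen w)
| ULeftFold u m of
    u != m & lk u \subset lk m & a (gen u) = gen m * gen u
    & (forall w, w != u -> a (gen w) = gen w)
| UPartialConj m (C : {set V}) of
    C \in components (~: st m)
    & (forall v, v \in C -> a (gen v) = (gen m)^-1 * gen v * gen m)
    & (forall v, v \notin C -> a (gen v) = gen v).

Definition untwisted : set (out raag) :=
  generated (@out_class raag @` untwisted_gen).

Definition inseparable (m : letter V) : {set {set letter V}} :=
  [set U : {set letter V} | [exists C in components (~: lk m.1),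
     [exists u, (C == [set u.1]) && (U == [set u])]
     || ((1 < #|C|)%N && (U == pm C))]].

Definition GW_subset (m : letter V) (P : {set letter V}) : bool :=
  [&& [exists I : {set {set letter V}},
         (I \subset inseparable m) && (P == finset.cover I)],
      m \in P & linv m \notin P].

Definition costar (m : letter V) (P : {set letter V}) : {set letter V} :=
  ~: pm (lk m.1) :\: P.

(* The image of the generator [v] under [phi (P, m)]. *)
Definition whitehead_map (m : letter V) (P : {set letter V}) (v : V) : raag :=
  let x := pos v in
  if [&& x \in P, linv x \in costar m P & v != m.1] then gen v * (lgen m)^-1
  else if [&& linv x \in P, x \in costar m P & v != m.1] then lgen m * gen v
  else if (x \in P) && (linv x \in P) then lgen m * gen v * (lgen m)^-1
  else gen v.

(* Automorphisms are determined by their values on generators; see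
   [whitehead_ex] for the existence of [phi (P, m)]. *)
Definition is_whitehead (a : aut raag) : Prop :=
  exists m P, GW_subset m P /\ forall v, a (gen v) = whitehead_map m P v.

(* The partition [{P | P^* | lk(m)^{+-}}], as a set of sets and hence unordered
   in [P] and [P^*]; its third part is empty when [lk m] is. *)
Definition GW_partition_of (m : letter V) (P : {set letter V})
    (PP : {set {set letter V}}) : bool :=
  [&& GW_subset m P, (1 < #|P|)%N, (1 < #|costar m P|)%N
    & PP == [set P; costar m P; pm (lk m.1)]].

Definition based_at (PP : {set {set letter V}}) (v : V) : bool :=
  [exists m, exists P, (m.1 == v) && GW_partition_of m P PP].

(* [commutesP] below: this is commutation of [m] and [n] in the group. *)
Definition commutes (m n : letter V) : bool := (m.1 == n.1) || e m.1 n.1.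

Definition compatible (PP QQ : {set {set letter V}}) : bool :=
  [exists m, exists P, exists n, exists Q,
    [&& GW_partition_of m P PP, GW_partition_of n Q QQ
      & [exists A in [set P; costar m P], exists B in [set Q; costar n Q],
           A :&: B == finset.set0]
        || commutes m n && (st m.1 != st n.1)]].

(* The collections of pairwise compatible partitions each of which is based at
   an element of [U]. *)
Definition compatible_collection (U : {set V})
    (C : {set {set {set letter V}}}) : bool :=
  [forall PP in C, [exists u in U, based_at PP u]]
  && [forall PP in C, forall QQ in C, (PP != QQ) ==> compatible PP QQ].

Definition max_compatible (U : {set V}) : nat :=
  \max_(C : {set {set {set letter V}}} | compatible_collection U C) #|C|.

End Raag.

Arguments untwisted {V} e _.
Arguments is_whitehead {V} e a.

Section Facts.
Variables (V : finType) (e : rel V).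
Hypotheses (e_sym : symmetric e) (e_irr : irreflexive e).

Lemma commutesP (m n : letter V) :
  reflect (commute (lgen e m) (lgen e n)) (commutes e m n).
Proof.
have cV (G : groupType) (x y : G) b :
    commute x y -> commute x (if b then y^-1 else y).
  by case: b => // /commuteV.
have cV2 (G : groupType) (x y : G) b c :
    commute (if b then x^-1 else x) (if c then y^-1 else y) <-> commute x y.
  have imp (x1 y1 : G) b1 c1 : commute x1 y1 ->
      commute (if b1 then x1^-1 else x1) (if c1 then y1^-1 else y1).
    by move=> /(cV _ _ _ c1)/commute_sym/(cV _ _ _ b1)/commute_sym.
  split; last exact: imp.
  by move/(imp _ _ b c); case: b; case: c; rewrite ?invgK.
rewrite !lgenE; apply: (iffP orP) => [[/eqP->|emn]|/cV2 cmn].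
- exact/cV2.
- exact/cV2/gen_comm.
apply/orP; apply: contraPT cmn; rewrite negb_or => /andP [mn emn].
pose a := tperm (Some true) None.
pose b := tperm (Some false) (None : option bool).
pose f v := if v == m.1 then a else if v == n.1 then b else 1.
have f_comm u v : e u v -> commute (f u) (f v).
  rewrite /f; case: (eqVneq u m.1) => [->|um]; case: (eqVneq v m.1) => [->|vm] //.
  - by case: eqVneq => [->|_ _]; [rewrite (negPf emn)|apply: commute1].
  - case: eqVneq => [->|_ _]; first by rewrite e_sym (negPf emn).
    exact/commute_sym/commute1.
  - case: (eqVneq u n.1) => [_|_ _]; last exact/commute_sym/commute1.
    by case: eqVneq => // _ _; apply: commute1.
move=> /(congr1 (raag_lift f)); rewrite !raag_liftM // !raag_lift_gen //.
rewrite /f eqxx eq_sym (negPf mn) eqxx => /permP /(_ (Some true)).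
by rewrite !permM /a /b !permE.
Qed.

(* The common form of [phi (P, m)] and its inverse. *)
Let twist (p q : pred V) (z : raag e) (v : V) : raag e :=
  (if p v then z else 1) * gen e v * (if q v then z^-1 else 1).

Lemma twist_aut (p q : pred V) (m : letter V) :
  (forall v, p v || q v -> (v != m.1) && (v \notin lk e m.1)) ->
  (forall v w, e v w -> v \notin lk e m.1 -> w \notin lk e m.1 ->
     [/\ p v = p w, q v = q w & p v = q v]) ->
  exists a : aut (raag e), forall v, a (gen e v) = twist p q (lgen e m) v.
Proof.
move=> pqm pqe.
have tcomm b u v : let z := lgen e (m.1, b) in
    e u v -> commute (twist p q z u) (twist p q z v).
  move=> z euv.
  wlog lku : u v euv /
      (u \in lk e m.1) || (u \notin lk e m.1) && (v \notin lk e m.1).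
    move=> wl; have [|] := boolP (u \in lk e m.1) => lku.
      by apply: wl; rewrite // lku.
    have [|] := boolP (v \in lk e m.1) => lkv; last first.
      by apply: wl; rewrite // lku lkv orbT.
    by apply/commute_sym/wl; rewrite ?lkv // e_sym.
  case/orP: lku => [lku|/andP[lku lkv]].
    have : ~~ (p u || q u) by apply/negP => /pqm; rewrite lku andbF.
    rewrite negb_or /twist => /andP[/negPf-> /negPf->]; rewrite mul1g mulg1.
    have uz : commute (gen e u) z.
      apply: (commutesP (pos u) (m.1, b)); rewrite /commutes /= e_sym.
      by rewrite inE in lku; rewrite lku orbT.
    apply: commuteM; first apply: commuteM.
    - by case: ifP => // _; apply: commute1.
    - exact: gen_comm.
    - by case: ifP => // _; [apply: commuteV|apply: commute1].
  have [pp qq pq] := pqe _ _ euv lku lkv.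
  rewrite /twist -qq -pp -pq; case: (p u); last first.
    by rewrite !mul1g !mulg1; apply: gen_comm.
  rewrite /commute !mulgA !mulgVK -!mulgA; congr (_ * _); rewrite !mulgA.
  by rewrite (gen_comm euv).
pose F (b : bool) (x : raag e) :=
  raag_lift (twist p q (lgen e (m.1, b))) x.
have FM b : {morph F b : x y / x * y} by apply/raag_liftM/tcomm.
have Fg b v : F b (gen e v) = twist p q (lgen e (m.1, b)) v by apply/raag_lift_gen/tcomm.
have F1 b : F b 1 = 1 by apply: (mulgI (F b 1)); rewrite -FM !mulg1.
have FV b x : F b x^-1 = (F b x)^-1.
  by apply/esym/mulg1_eq; rewrite -FM mulgV F1.
have Fm b c : F b (lgen e (m.1, c)) = lgen e (m.1, c).
  have Fm0 : F b (gen e m.1) = gen e m.1.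
    rewrite Fg /twist; have : ~~ (p m.1 || q m.1).
      by apply/negP => /pqm; rewrite eqxx.
    by rewrite negb_or => /andP[/negPf-> /negPf->]; rewrite mul1g mulg1.
  by rewrite lgenE /=; case: c; rewrite ?FV Fm0.
have FK b : cancel (F b) (F (~~ b)).
  apply: (@raag_morph_eq _ _ _ (fun x => F (~~ b) (F b x)) id) => [x y|//|v].
    by rewrite !FM.
  have zV : lgen e (m.1, ~~ b) = (lgen e (m.1, b))^-1 by rewrite -lgenV.
  rewrite /= Fg /twist !FM Fg /twist zV.
  case: (p v); case: (q v); rewrite ?FV ?F1 ?Fm ?invg1 ?mul1g ?mulg1 ?invgK //.
  - by rewrite !mulgA mulgV mul1g mulgK.
  - by rewrite !mulgA mulgV mul1g.
  - by rewrite mulgK.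
have FK' : cancel (F (~~ m.2)) (F m.2) by rewrite -{2}[m.2]negbK; apply: FK.
exists (Aut (FM m.2) (FK m.2) FK') => v /=.
by rewrite Fg; case: m {pqm pqe tcomm F FM Fg F1 FV Fm FK FK'}.
Qed.

Lemma GW_subset_lk (m : letter V) P x :
  GW_subset e m P -> x \in P -> x.1 \notin lk e m.1.
Proof.
case/and3P=> /existsP[I /andP[/fintype.subsetP sI /eqP->]] _ _ /finset.bigcupP[U /sI].
rewrite inE => /existsP[C /andP[/imsetP[z zW ->]]] /orP[|]; last first.
  by case/andP=> _ /eqP->; rewrite !inE => /andP[].
case/existsP=> u /andP[/eqP Cu /eqP->]; rewrite inE => /eqP->.
by have := set11 u.1; rewrite -Cu !inE => /andP[].
Qed.

Lemma GW_subset_adj (m : letter V) P x y :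
  GW_subset e m P -> x \in P -> (x.1 == y.1) || e x.1 y.1 ->
  (exists2 w, e x.1 w & w \notin lk e m.1) -> y.1 \notin lk e m.1 -> y \in P.
Proof.
move=> GWP xP; have xlk := GW_subset_lk GWP xP.
case/and3P: GWP xP => /existsP[I /andP[/fintype.subsetP sI /eqP->]] _ _.
case/finset.bigcupP=> U IU Ux xy [w xw wlk] ylk; apply/finset.bigcupP; exists U => //.
move/sI: IU; rewrite inE => /existsP[C /andP[/imsetP[z zW ->]]].
set C0 := [set _ in _ | _].
have adj a b : a \in C0 -> b \notin lk e m.1 -> (a == b) || e a b -> b \in C0.
  rewrite /C0 inE => /andP[alk za] blk; rewrite inE.
  rewrite inE in alk; rewrite [b \in ~: _]inE blk /=.
  case/orP=> [/eqP <-//|ab]; apply: connect_trans za (connect1 _) => /=.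
  by rewrite ![_ \in ~: _]inE alk blk.
case/orP=> [/existsP[u /andP[/eqP Cu /eqP Uu]]|/andP[_ /eqP UC]].
  move: Ux xw; rewrite Uu => /finset.set1P -> uw.
  have : w \in C0 by apply: (adj u.1) => //; rewrite ?Cu ?set11 ?uw ?orbT.
  by rewrite Cu => /finset.set1P wu; move: uw; rewrite wu e_irr.
by move: Ux; rewrite UC inE => Cx; rewrite inE; apply: adj Cx ylk xy.
Qed.

Lemma whitehead_ex (m : letter V) (P : {set letter V}) :
  GW_subset e m P ->
  exists a : aut (raag e), forall v, a (gen e v) = whitehead_map e m P v.
Proof.
move=> GWP.
pose p v := (linv (pos v) \in P) && (v != m.1).
pose q v := (pos v \in P) && (v != m.1).
have lkP x : x \in P -> x.1 \notin lk e m.1 by apply: GW_subset_lk.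
have [a aE] : exists a : aut (raag e),
    forall v, a (gen e v) = twist p q (lgen e m) v.
  apply: twist_aut => [v /orP[]/andP[/lkP vlk ->]//|v w evw vlk wlk].
  have neq u u' : e u u' -> u' \notin lk e m.1 -> u != m.1.
    by move=> uu' u'lk; apply/eqP => um; case/negP: u'lk; rewrite -um inE.
  have ewv : e w v by rewrite e_sym.
  have wm := neq _ _ ewv vlk; have vm := neq _ _ evw wlk.
  have move_ x y : x \in P -> y.1 \in [set v; w] -> x.1 \in [set v; w] -> y \in P.
    move=> xP yvw xvw; apply: (GW_subset_adj GWP xP).
    - move: xvw yvw; rewrite !inE => /orP[]/eqP-> /orP[]/eqP->;
      by rewrite ?eqxx ?evw ?ewv ?orbT.
    - by case/set2P: xvw => ->; [exists w|exists v].
    - by case/set2P: yvw => ->.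
  rewrite /p /q vm wm !andbT.
  by split; apply/idP/idP => xP; apply: move_ xP _ _; rewrite !inE eqxx ?orbT.
exists a => v; rewrite aE /twist /whitehead_map /p /q /costar.
have [vm|vm] := eqVneq v m.1; rewrite ?andbF ?andbT.
  case/and3P: GWP => _ mP nmP; rewrite mul1g mulg1; case: ifP => // /andP[].
  move: mP nmP; rewrite vm; case: (m) => u [] /=; rewrite /linv /pos /=.
    by move=> _ /negPf->.
  by move=> _ /negPf->.
rewrite !inE /=.
case vP: (pos v \in P); case vP': (linv (pos v) \in P); rewrite /= ?mul1g ?mulg1 //.
- by have := lkP _ vP; rewrite inE /= => ->.
- by have := lkP _ vP'; rewrite inE /= => ->.
Qed.

End Facts.

(* Main.v *)
Require Import Defs.
From mathcomp Require Import all_boot all_order all_algebra perm monoid.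
From mathcomp Require Import boolp classical_sets.
Set Implicit Arguments.
Unset Strict Implicit.
Unset Printing Implicit Defensive.

(** Fix a vertex [v].  Up to inner automorphisms, an automorphism [phi (P, v)]
    is the function [1_P] on the letters off the star of [v], and products of
    such automorphisms add these functions, constants being inner.  A family
    of Whitehead automorphisms therefore colours, for each [v], the letters off
    the star of [v]: two letters get the same colour when they lie on the same
    side of every member of the family based at [v].  Those members generate a
    group of rank at most the number of colours minus one, the excess of [v],
    so that [k] is at most the total excess ([free_abelian_rank_le]).  On the
    other hand a linear order on the colours at [v] yields a chain of
    partitions based at [v], one for each unit of excess.

    The members commute in [Out], which ties the colourings together.  Let [m]
    and [n] be distinct, non-adjacent, and both with at least two colours.
    Then [n] and its inverse have the same colour at [m], and conversely;
    moreover a letter cannot both differ from [n] in colour at [m] and differ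
    from [m] in colour at [n] ([commuting_sides]).  This is detected in the
    symmetric group on three letters: sending [m] and [n] to two transpositions
    and a third letter to an arbitrary permutation, the conjugating element of
    the commutation relation is determined by the images of [m] and [n], and
    freedom in the third letter forces the combinatorial conditions.
    Colourings with this property, and which respect adjacency, are called
    coherent.

    Coherent colourings can be moved away from non-principal vertices.  If
    [lk m] is contained in [lk w], the colours at [m] other than that of [w]
    lie, in the colouring at [w], inside the colour of [m]; subdividing that
    colour and making [m] monochromatic does not lower the total excess
    ([transfer_excess]).  The result is coherent provided that no other vertex
    [n] separates [m] from [w].  Such an [n] has [lk m] inside [lk n] and sees
    strictly more letters beyond itself, so a vertex [w] for which this set of
    letters is largest is a legitimate target ([transfer_target]).  Iterating,
    only principal vertices keep several colours ([make_principal]).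

    Vertices with the same star need a common order on colours to have
    compatible chains, hence they are given the common refinement of their
    colourings.  The chains of all principal vertices then form a compatible
    collection: chains at vertices with the same star are nested, chains at
    adjacent vertices with different stars are compatible by definition, and
    coherence provides disjoint sides for the others
    ([collection_of_colouring]). *)

(** * The symmetric group on three letters *)

Section PermThree.

Local Open Scope group_scope.

Let T3 : finType := option bool.
Definition swap1 : {perm T3} := tperm (Some true) None.
Definition swap2 : {perm T3} := tperm (Some false) None.

Lemma swap1V : swap1^-1 = swap1. Proof. exact: tpermV. Qed.
Lemma swap2V : swap2^-1 = swap2. Proof. exact: tpermV. Qed.

Lemma swaps_centralizer (k : {perm T3}) :
  commute k swap1 -> commute k swap2 -> k = 1.
Proof.
move=> /permP c1 /permP c2.
have kf : k (Some false) = Some false.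
  have := c1 (Some false); rewrite !permM /swap1 !permE /=.
  by case: (k _) => [[]|].
have kt : k (Some true) = Some true.
  have := c2 (Some true); rewrite !permM /swap2 !permE /=.
  by case: (k _) => [[]|].
apply/permP=> x; rewrite perm1; case: x => [[]|] //.
by have := c1 (Some true); rewrite !permM /swap1 kt !permE.
Qed.

(** Taking [X = 1] shows that [B1 / B2] commutes with every [X], and the centre
    is trivial. *)
Lemma swaps_sandwich (A1 B1 A2 B2 : {perm T3}) :
  (forall X, A1 * X * B1 = A2 * X * B2) -> B1 = B2.
Proof.
move=> AB; suff E : B1 * B2^-1 = 1 by rewrite -[B1](mulgVK B2) E mul1g.
suff cX X : commute (B1 * B2^-1) X by apply: swaps_centralizer.
have ABX Y : A2^-1 * A1 * Y = Y * (B2 * B1^-1).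
  apply: (mulgI A2); apply: (mulIg B1).
  by rewrite !mulgA mulgV mul1g mulgVK AB.
have := ABX 1; rewrite mulg1 mul1g => A21.
have cX : commute X (B2 * B1^-1) by rewrite /commute -ABX A21.
by have := commute_sym (commuteV cX); rewrite invgM invgK.
Qed.

End PermThree.

(** * Commuting Whitehead automorphisms *)

Section Commutation.

Local Open Scope group_scope.

Variables (V : finType) (e : rel V).
Hypotheses (e_sym : symmetric e) (e_irr : irreflexive e).
Implicit Types (m n x y : letter V) (P Q : {set letter V}).

Definition whitehead_for m P (a : aut (raag e)) : Prop :=
  GW_subset e m P /\ forall v, a (gen e v) = whitehead_map e m P v.

(** The base letter lies in [P] but is fixed by [phi (P, m)]. *)
Definition moved m P y : bool := (y \in P) && (y.1 != m.1).

(** The four cases defining [phi (P, m)] become one formula once it is applied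
    to letters rather than to vertices. *)
Lemma whitehead_lgen m P a y : whitehead_for m P a ->
  a (lgen e y) =
    lgen e m ^+ moved m P (linv y) * lgen e y * lgen e m ^- moved m P y.
Proof.
case=> GWP aE.
have lkP z : z \in P -> z.1 \notin lk e m.1 by apply: GW_subset_lk.
have apos v : a (gen e v) = lgen e m ^+ moved m P (linv (pos v)) * gen e v
    * lgen e m ^- moved m P (pos v).
  rewrite aE /whitehead_map /costar /moved /=.
  have [->|vm] := eqVneq v m.1; rewrite ?andbF ?andbT.
    rewrite !expg0 mul1g invg1 mulg1; case: ifP => // /andP[].
    case/and3P: GWP => _ mP nmP; move: mP nmP.
    by case: (m) => u [] /=; rewrite /linv /pos /= => mP /negPf nmP;
      rewrite ?mP ?nmP.
  rewrite !inE /=.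
  case vP: (pos v \in P); case vP': (linv (pos v) \in P);
    rewrite /= ?andbF ?andbT ?expg0 ?expg1 ?mul1g ?invg1 ?mulg1 //.
  - by have := lkP _ vP; rewrite inE /= => ->.
  - by have := lkP _ vP'; rewrite inE /= => ->.
case: y => v []; last exact: apos.
rewrite -[(v, true)]/(linv (pos v)) lgenV -/(gen e v) autV apos linvK.
by rewrite !invgM invgK mulgA.
Qed.

Lemma autXb (G : groupType) (a : aut G) (g : G) (b : bool) : a (g ^+ b) = a g ^+ b.
Proof. by case: b; rewrite ?expg0 ?expg1 ?aut1. Qed.

Lemma out_commute (G : groupType) (a b : aut G) :
  commute (out_class a) (out_class b) ->
  exists h, forall g, a (b g) = h * b (a g) * h^-1.
Proof.
by rewrite /commute -[LHS]out_classM -[RHS]out_classM => /out_classP.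
Qed.

Section LiftV.
Variables (G : groupType) (f : V -> G).
Hypothesis f_comm : forall u v, e u v -> commute (f u) (f v).

Lemma raag_lift1 : raag_lift f (1 : raag e) = 1.
Proof. by apply: (mulgI (raag_lift f (1 : raag e))); rewrite -raag_liftM // !mulg1. Qed.

Lemma raag_liftV : {morph @raag_lift _ e _ f : a / a^-1}.
Proof. by move=> a; apply/esym/mulg1_eq; rewrite -raag_liftM // mulgV raag_lift1. Qed.

Lemma raag_liftXb (a : raag e) (b : bool) : raag_lift f (a ^+ b) = raag_lift f a ^+ b.
Proof. by case: b; rewrite ?expg0 ?expg1 ?raag_lift1. Qed.
End LiftV.

Section Pair.
Variables (m n : letter V) (P Q : {set letter V}) (a b : aut (raag e)).
Hypotheses (aP : whitehead_for m P a) (bQ : whitehead_for n Q b).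
Hypothesis mn : m.1 != n.1.
Hypothesis ab : commute (out_class a) (out_class b).

Let nm : n.1 != m.1. Proof. by rewrite eq_sym. Qed.

Let a_base : a (lgen e m) = lgen e m.
Proof.
by rewrite (whitehead_lgen _ aP) /moved eqxx !andbF expg0 mul1g invg1 mulg1.
Qed.

Let b_base : b (lgen e n) = lgen e n.
Proof.
by rewrite (whitehead_lgen _ bQ) /moved eqxx !andbF expg0 mul1g invg1 mulg1.
Qed.

(** If [P] separated [n] from its inverse and [Q] separated [m] from its
    inverse, the two automorphisms would act by non-commuting transvections on
    the exponent sums of [m] and [n].  The parity of the exponent of [n] in the
    two images of [n] already differs. *)
Lemma commuting_not_both_split :
  (n \in P) = (linv n \in P) \/ (m \in Q) = (linv m \in Q).
Proof.
have [h hE] := out_commute ab.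
pose f u : {perm bool} := if u == n.1 then tperm true false else 1.
have fC u v : e u v -> commute (f u) (f v).
  move=> _; rewrite /f; case: ifP => _; case: ifP => _ //.
    exact: commute1.
  exact/commute_sym/commute1.
pose o g := odd_perm (raag_lift f (g : raag e)).
have oM g g' : o (g * g') = o g (+) o g' by rewrite /o raag_liftM // odd_permM.
have oV g : o g^-1 = o g by rewrite /o raag_liftV // odd_permV.
have oX g (c : bool) : o (g ^+ c) = c && o g.
  by rewrite /o raag_liftXb //; case: c; rewrite ?expg0 ?odd_perm1.
have ol y : o (lgen e y) = (y.1 == n.1).
  rewrite lgenE; case: y.2; rewrite ?oV /o raag_lift_gen // /f;
    by case: ifP; rewrite ?odd_tperm ?odd_perm1.
have := congr1 o (hE (lgen e n)); rewrite b_base !oM oV.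
rewrite !(whitehead_lgen _ aP) (autM b) (autM b) autV !autXb b_base.
rewrite (whitehead_lgen _ bQ) !(oM, oV, oX, ol) eqxx (negPf mn) !andbF !andbT.
rewrite /moved /= mn nm !andbT.
case: (o h); case: (n \in P); case: (linv n \in P); case: (m \in Q);
  case: (linv m \in Q) => //= _; auto.
Qed.

(** When [n] and its inverse are on the same side of [P], the first
    automorphism conjugates [n] by a power of [m].  Map [m] and [n] to two
    transpositions and [x] to an arbitrary permutation [X].  The relations for
    [m] and [n] leave only one possible conjugator, whatever [X] is, and then
    the relation for [x] compares two words surrounding [X], which must agree
    on the right.  Since [x] and [n] are on different sides of [P], parity
    gives the first conclusion and non-commutation of the transpositions the
    second. *)
Lemma commuting_side x :
  ~~ e m.1 n.1 -> (n \in P) = (linv n \in P) ->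
  x.1 \notin st e m.1 -> x.1 \notin st e n.1 -> (x \in P) != (n \in P) ->
  (m \in Q) = (linv m \in Q) /\ (x \in Q) = (m \in Q).
Proof.
move=> emn nP; rewrite !inE !negb_or => /andP[xm emx] /andP[xn enx] xP.
have [h0 hE] := out_commute ab.
pose f X u := if u == m.1 then swap1 else if u == n.1 then swap2
  else if u == x.1 then X else 1.
have fC X u v : e u v -> commute (f X u) (f X v).
  have c1 g : commute (1 : {perm option bool}) g by apply/commute_sym/commute1.
  rewrite /f; case: (eqVneq u m.1) => [->|um].
    case: (eqVneq v m.1) => [->|vm] //.
    case: (eqVneq v n.1) => [->|vn]; first by rewrite (negPf emn).
    by case: (eqVneq v x.1) => [->|vx]; rewrite ?(negPf emx) // => _; apply: commute1.
  case: (eqVneq u n.1) => [->|un].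
    case: (eqVneq v m.1) => [->|vm]; first by rewrite e_sym (negPf emn).
    case: (eqVneq v n.1) => [->|vn] //.
    by case: (eqVneq v x.1) => [->|vx]; rewrite ?(negPf enx) // => _; apply: commute1.
  case: (eqVneq u x.1) => [->|ux] // euv.
  case: (eqVneq v m.1) euv => [->|vm]; first by rewrite e_sym (negPf emx).
  case: (eqVneq v n.1) => [->|vn]; first by rewrite e_sym (negPf enx).
  by case: (eqVneq v x.1) => [->|vx] // _; apply: commute1.
pose r X (g : raag e) := raag_lift (f X) g.
have rM X g g' : r X (g * g') = r X g * r X g' by rewrite /r raag_liftM //; apply: fC.
have rV X g : r X g^-1 = (r X g)^-1 by rewrite /r raag_liftV //; apply: fC.
have rX X g (c : bool) : r X (g ^+ c) = r X g ^+ c by rewrite /r raag_liftXb //; apply: fC.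
have rm X : r X (lgen e m) = swap1.
  have Em : r X (gen e m.1) = swap1 by rewrite /r (raag_lift_gen (@fC _)) /f eqxx.
  by rewrite lgenE; case: m.2; rewrite ?rV Em ?swap1V.
have rn X : r X (lgen e n) = swap2.
  have En : r X (gen e n.1) = swap2.
    by rewrite /r (raag_lift_gen (@fC _)) /f (negPf nm) eqxx.
  by rewrite lgenE; case: n.2; rewrite ?rV En ?swap2V.
have rx X : r (if x.2 then X^-1 else X) (lgen e x) = X.
  have Ex Y : r Y (gen e x.1) = Y.
    by rewrite /r (raag_lift_gen (@fC _)) /f (negPf xm) (negPf xn) eqxx.
  by rewrite lgenE; case: x.2; rewrite ?rV Ex ?invgK.
pose M := swap1; pose N := swap2.
pose p := linv x \in P; pose q := x \in P; pose s := n \in P.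
pose c := linv x \in Q; pose d := x \in Q.
pose c' := linv m \in Q; pose d' := m \in Q.
pose K := M ^+ s; pose Z := N ^+ c' * M * N ^- d'.
have KV : K^-1 = K by rewrite /K; case: (s); rewrite ?expg0 ?invg1 // swap1V.
have an X : r X (a (lgen e n)) = K * N * K.
  rewrite (whitehead_lgen _ aP) !rM rV !rX rm rn /moved /= nm !andbT -nP.
  by rewrite -/s -/M -/K KV.
have bm X : r X (b (lgen e m)) = Z.
  by rewrite (whitehead_lgen _ bQ) !rM rV !rX rm rn /moved /= mn !andbT.
have KK g : K * (K * g) = g by rewrite -{1}KV mulKg.
have KM : K * M = M * K by rewrite /K; case: (s); rewrite ?expg0 ?mul1g ?mulg1.
have KMK g : K * (M * (K * g)) = M * g by rewrite mulgA KM -mulgA KK.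
have anX (t : bool) : (K * N * K) ^+ t = K * N ^+ t * K.
  case: t; rewrite ?expg1 ?expg0 // mulg1.
  by rewrite -{1}KV mulVg.
have anXV (t : bool) : (K * N * K) ^- t = K * N ^- t * K.
  by rewrite anX !invgM KV mulgA.
(* The element K h Z^s commutes with Z and N, which generate the group. *)
have hX X : r X h0 = K * Z ^- s.
  set h := r X h0.
  have Em : K * Z * K = h * Z * h^-1.
    have := congr1 (r X) (hE (lgen e m)).
    rewrite a_base !rM rV bm (whitehead_lgen _ bQ) (autM a) (autM a) autV !autXb.
    rewrite a_base !rM rV !rX an rm /moved /= mn !andbT -/c' -/d' anX anXV => <-.
    by rewrite /Z -!mulgA KMK.
  have En : K * N * K = h * (Z ^+ s * N * Z ^- s) * h^-1.
    have := congr1 (r X) (hE (lgen e n)).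
    rewrite b_base an !rM rV (whitehead_lgen _ aP) (autM b) (autM b) autV !autXb.
    by rewrite b_base !rM rV !rX bm rn /moved /= nm !andbT -nP.
  have ZZ : commute (Z ^+ s) Z.
    by apply/commute_sym/commuteX.
  suff k1 : K * h * Z ^+ s = 1.
    by rewrite -[h](mulgK (Z ^+ s)) -[h * _]KK (mulgA K h) k1 mulg1.
  have cZ : commute (K * h * Z ^+ s) Z.
    rewrite /commute.
    have -> : K * h * Z ^+ s * Z = K * (h * Z * h^-1) * h * Z ^+ s.
      by rewrite -(mulgA (K * h)) ZZ !mulgA !mulgVK.
    by rewrite -Em !mulgA -{1}KV mulVg mul1g.
  have cN : commute (K * h * Z ^+ s) N.
    rewrite /commute.
    have -> : K * h * Z ^+ s * N = K * (h * (Z ^+ s * N * Z ^- s) * h^-1) * h * Z ^+ s.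
      by rewrite !mulgA !mulgVK.
    by rewrite -En !mulgA -{1}KV mulVg mul1g.
  apply: swaps_centralizer => //.
  have -> : swap1 = N ^- c' * Z * N ^+ d'.
    by rewrite /Z !mulgA mulVg mul1g mulgVK.
  by apply: commuteM; [apply: commuteM => //; apply/commuteV/commuteX|apply: commuteX].
have key : M ^- q * K * N ^- d = N ^- d * Z ^- q * Z ^+ s.
  apply: (@swaps_sandwich (N ^+ c * K * M ^+ p) _ (Z ^- s * Z ^+ p * N ^+ c)) => X.
  (* The generator under x is sent to X or its inverse, so that the letter x
     itself goes to X. *)
  pose Y := if x.2 then X^-1 else X.
  have := congr1 (r Y) (hE (lgen e x)).
  rewrite (whitehead_lgen _ bQ) (whitehead_lgen _ aP).
  rewrite 2!(autM a) 2!(autM b) !autV !autXb (whitehead_lgen x aP) (whitehead_lgen x bQ).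
  rewrite /moved /= xm xn !andbT -/p -/q -/c -/d.
  rewrite !rM !rV !rX an bm rm rn rx hX anX anXV.
  rewrite -/M -/N invgM invgK KV => E; apply: (mulgI K); apply: (mulIg K).
  by move: E; rewrite !mulgA.
(* The parity of both sides is kept next to the equation: it excludes the cases
   where Z is a 3-cycle. *)
have {key} : odd_perm (M ^- q * K * N ^- d) = odd_perm (N ^- d * Z ^- q * Z ^+ s) /\
   M ^- q * K * N ^- d = N ^- d * Z ^- q * Z ^+ s by rewrite key.
have oM : odd_perm M by rewrite odd_tperm.
have oN : odd_perm N by rewrite odd_tperm.
move: xP; rewrite -/q -/s -/c' -/d' -/d.
have MN : M * N <> N * M.
  by move=> /permP /(_ (Some true)); rewrite !permM /M /N /swap1 /swap2 !permE.
have NN g : N * (N * g) = g by rewrite -{1}(swap2V : N^-1 = N) mulKg.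
rewrite /K /Z; move: (q) (s) (d) (c') (d') => [] [] // [] [] [] _ [];
  rewrite ?expg0 ?expg1 ?invg1 ?mul1g ?mulg1 ?(odd_permM, odd_permV) ?oM ?oN //=.
all: rewrite ?invgM ?swap1V ?swap2V ?invg1 ?mul1g ?mulg1 -?mulgA ?NN.
all: move=> _ // E; exfalso; solve [exact: MN E | exact: MN (esym E)
  | by apply: MN; rewrite -/M -/N in E *; rewrite {2}E NN].
Qed.

End Pair.
End Commutation.

Lemma letter_cases (V : finType) (n x : letter V) :
  x.1 = n.1 -> x = n \/ x = linv n.
Proof. by case: n x => [v []] [w []] /= ->; [left|right|right|left]. Qed.

Lemma letterP (V : finType) (v : V) (x : letter V) :
  x.1 = v -> x = pos v \/ x = linv (pos v).
Proof. exact: (@letter_cases _ (pos v)). Qed.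

Section Sides.

Local Open Scope group_scope.

Variables (V : finType) (e : rel V).
Hypotheses (e_sym : symmetric e) (e_irr : irreflexive e).
Implicit Types (m n x y : letter V) (P Q : {set letter V}).

Definition off_star (v : V) : {set letter V} := ~: pm (st e v).

Lemma off_starE v x : (x \in off_star v) = (x.1 != v) && ~~ e v x.1.
Proof. by rewrite !inE negb_or. Qed.

Definition splits m P : bool :=
  [exists x in off_star m.1, exists y in off_star m.1, (x \in P) != (y \in P)].

Lemma splitsPn m P x y : ~~ splits m P ->
  x \in off_star m.1 -> y \in off_star m.1 -> (x \in P) = (y \in P).
Proof.
move=> sP xm ym; apply/eqP; apply: contraNT sP => xyP.
by apply/existsP; exists x; rewrite xm /=; apply/existsP; exists y; rewrite ym.
Qed.

(** Adjacent vertices off the star of [m] lie in one component of the complement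
    of [lk m], and that component is not a single vertex. *)
Lemma GW_subset_same_side m P x y : GW_subset e m P ->
  x \in off_star m.1 -> y \in off_star m.1 -> e x.1 y.1 ->
  (x \in P) = (y \in P).
Proof.
move=> GWP; rewrite !off_starE => /andP[_ xm] /andP[_ ym] exy.
apply/idP/idP=> [xP|yP].
  apply: (GW_subset_adj e_irr GWP xP); rewrite ?exy ?orbT ?inE //.
  by exists y.1; rewrite ?inE.
apply: (GW_subset_adj e_irr GWP yP); rewrite ?[e y.1 _]e_sym ?exy ?orbT ?inE //.
by exists x.1; rewrite ?[e y.1 _]e_sym ?inE.
Qed.

(** A letter on the other side of [P] than [n] is automatically off the star of
    [n]: it is not adjacent to [n] by inseparability, and it is not the inverse
    of [n] by assumption. *)
Lemma commuting_unsplit_sides m n P Q (a b : aut (raag e)) :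
  whitehead_for m P a -> whitehead_for n Q b -> m.1 != n.1 -> ~~ e m.1 n.1 ->
  commute (out_class a) (out_class b) ->
  (n \in P) = (linv n \in P) -> splits m P ->
  (m \in Q) = (linv m \in Q) /\
  forall x, x \in off_star m.1 -> x \in off_star n.1 ->
    (x \in P) = (n \in P) \/ (x \in Q) = (m \in Q).
Proof.
move=> aP bQ mn emn ab nP sP.
have side := commuting_side e_sym aP bQ mn ab emn nP.
have nm : n \in off_star m.1 by rewrite off_starE eq_sym mn.
have sx x : x \in off_star m.1 -> x.1 \notin st e m.1 by rewrite !inE.
split; last first.
  move=> x /sx xm xn; case: (eqVneq (x \in P) (n \in P)) => [->|xP]; first by left.
  by right; apply: (proj2 (side x xm _ xP)); move: xn; rewrite !inE.
have [x xm xP] : exists2 x, x \in off_star m.1 & (x \in P) != (n \in P).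
  case/existsP: sP => x /andP[xm /existsP[y /andP[ym]]].
  case: (eqVneq (x \in P) (n \in P)) => [-> ny|nx _]; last by exists x.
  by exists y; rewrite // eq_sym.
apply: (proj1 (side x (sx _ xm) _ xP)); rewrite !inE negb_or; apply/andP; split.
  by apply: contraNneq xP => /letter_cases[->|->]; rewrite ?nP.
by apply: contraNN xP => enx; rewrite (GW_subset_same_side (proj1 aP) nm xm enx).
Qed.

Lemma commuting_sides m n P Q (a b : aut (raag e)) :
  whitehead_for m P a -> whitehead_for n Q b -> m.1 != n.1 -> ~~ e m.1 n.1 ->
  commute (out_class a) (out_class b) -> splits m P -> splits n Q ->
  [/\ (n \in P) = (linv n \in P), (m \in Q) = (linv m \in Q)
    & forall x, x \in off_star m.1 -> x \in off_star n.1 ->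
        (x \in P) = (n \in P) \/ (x \in Q) = (m \in Q)].
Proof.
move=> aP bQ mn emn ab sP sQ.
have nP : (n \in P) = (linv n \in P).
  case: (commuting_not_both_split aP bQ mn ab) => // mQ.
  have [||nP _] := commuting_unsplit_sides bQ aP _ _ (commute_sym ab) mQ sQ => //.
    by rewrite eq_sym.
  by rewrite e_sym.
by have [] := commuting_unsplit_sides aP bQ mn emn ab nP sP.
Qed.

End Sides.

(** * Integer exponents *)

Section IntegerPowers.

Local Open Scope group_scope.

Variable G : groupType.
Implicit Types (g : G) (p q : int).

Definition zexp g p : G :=
  match p with Posz k => g ^+ k | Negz k => g ^- k.+1 end.

Lemma zexpB g (i j : nat) : zexp g (i%:Z - j%:Z)%R = g ^+ i * g ^- j.
Proof.
have [ji|ij] := leqP j i; first by rewrite subzn //= expgnFr.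
rewrite -GRing.opprB subzn ?(ltnW ij) // -(subnSK ij) -NegzE /= subnSK //.
by rewrite expgnFr ?(ltnW ij) // invgM invgK.
Qed.

Lemma int_diff p : exists i j : nat, p = (i%:Z - j%:Z)%R.
Proof.
case: p => k; first by exists k, 0%N; rewrite GRing.subr0.
by exists 0%N, k.+1; rewrite NegzE GRing.sub0r.
Qed.

Lemma zexpD g p q : zexp g (p + q)%R = zexp g p * zexp g q.
Proof.
have [i [j ->]] := int_diff p; have [k [l ->]] := int_diff q.
have -> : (i%:Z - j%:Z + (k%:Z - l%:Z) = (i + k)%N%:Z - (j + l)%N%:Z)%R.
  by rewrite !PoszD GRing.opprD GRing.addrACA.
rewrite !zexpB !expgnDr invgM.
have c : commute (g ^- j) (g ^+ k).
  by apply/commute_sym/commuteV/commuteX2.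
have c' : commute (g ^- j) (g ^- l) by apply/commuteV/commute_sym/commuteV/commuteX2.
by rewrite -!mulgA (mulgA (g ^- j)) c -!mulgA c'.
Qed.

Lemma zexpN g p : zexp g (- p)%R = (zexp g p)^-1.
Proof. by apply/esym/mulg1_eq; rewrite -zexpD GRing.subrr. Qed.

Lemma commute_zexp g x p : commute x g -> commute x (zexp g p).
Proof. by move=> xg; case: p => k /=; [|apply: commuteV]; apply: commuteX. Qed.

Lemma zexpb g (s : bool) (b : bool) :
  zexp g (if b then (-1) ^+ s else 0)%R = (if s then g^-1 else g) ^+ b.
Proof. by case: s; case: b. Qed.

Lemma aut_zexp (a : aut G) g p : a g = g -> a (zexp g p) = zexp g p.
Proof.
move=> ag; have aX i : a (g ^+ i) = g ^+ i.
  by elim: i => [|i IHi]; rewrite ?expg0 ?aut1 // !expgS autM IHi ag.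
by case: p => i /=; rewrite ?autV aX.
Qed.

End IntegerPowers.

Section Exponents.

Local Open Scope group_scope.

Variables (V : finType) (e : rel V).
Hypotheses (e_sym : symmetric e) (e_irr : irreflexive e).
Implicit Types (v : V) (m x y : letter V) (F : {ffun letter V -> int}).

(** The automorphisms that multiply letters on both sides by powers of [v]; on
    exponents, composition is addition. *)
Definition multiplies v F (a : aut (raag e)) : Prop :=
  forall y, a (lgen e y) =
    zexp (gen e v) (F (linv y)) * lgen e y * (zexp (gen e v) (F y))^-1.

Definition fixes_star v F : Prop := forall y, y \notin off_star e v -> F y = 0%R.

Lemma multiplies1 v : multiplies v 0%R 1.
Proof. by move=> y; rewrite !ffunE invg1 mulg1 mul1g. Qed.

Lemma multiplies_base v F a : fixes_star v F -> multiplies v F a ->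
  a (gen e v) = gen e v.
Proof.
move=> F0 aF; rewrite -[gen e v]/(lgen e (pos v)) aF.
by rewrite !F0 ?off_starE ?eqxx // invg1 mulg1 mul1g.
Qed.

Lemma multipliesM v F F' a b : fixes_star v F ->
  multiplies v F a -> multiplies v F' b -> multiplies v (F + F')%R (a * b).
Proof.
move=> F0 aF bF y; have av := multiplies_base F0 aF.
rewrite -[LHS]/(a (b (lgen e y))) bF 2!autM autV !(aut_zexp _ av) aF !ffunE.
by rewrite !(GRing.addrC (F _)) !zexpD !invgM !mulgA.
Qed.

Lemma multipliesV v F a : fixes_star v F ->
  multiplies v F a -> multiplies v (- F)%R a^-1.
Proof.
move=> F0 aF y; have av := multiplies_base F0 aF.
have aI : injective a := can_inj (autK a).
apply: aI; rewrite [LHS](autVK a) 2!autM autV !(aut_zexp _ av) aF !ffunE !zexpN.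
by rewrite invgK !mulgA mulVg mul1g mulgVK.
Qed.

(** A constant exponent off the star is conjugation by a power of [v], because
    the letters of the star commute with [v]. *)
Lemma multiplies_inner v F a (c : int) : multiplies v F a ->
  (forall y, F y = if y \in off_star e v then c else 0%R) -> out_class a = 1.
Proof.
move=> aF Fc; apply/(out_classP a 1); exists (zexp (gen e v) c).
apply: raag_morph_eq => [x y|x y|u]; first exact: autM.
  by rewrite /= !mulgA mulgVK.
change (a (lgen e (pos u)) = zexp (gen e v) c * gen e u * (zexp (gen e v) c)^-1).
rewrite aF !Fc !off_starE /=.
case: ifP => // /negbT uv; rewrite mul1g invg1 mulg1.
suff /(commute_zexp c) cuv : commute (gen e u) (gen e v).
  by rewrite -cuv mulgK.
move: uv; rewrite negb_and !negbK => /orP[/eqP->//|evu].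
exact/commute_sym/gen_comm.
Qed.

(** The sign records whether the base letter is the vertex or its inverse. *)
Definition exponent m (P : {set letter V}) : {ffun letter V -> int} :=
  [ffun y => if moved m P y then (-1) ^+ m.2 else 0]%R.

Lemma exponent_fixes_star m P (a : aut (raag e)) : whitehead_for m P a ->
  fixes_star m.1 (exponent m P).
Proof.
case=> GWP _ y; rewrite off_starE ffunE /moved negb_and negbK.
case: eqP => [|_ /negPn my]; rewrite ?andbF //.
by case: ifP => // /andP[/(GW_subset_lk GWP)]; rewrite inE my.
Qed.

Lemma exponent_multiplies m P (a : aut (raag e)) : whitehead_for m P a ->
  multiplies m.1 (exponent m P) a.
Proof.
move=> aP y; rewrite (whitehead_lgen _ aP) !ffunE !zexpb.
by rewrite -/(lgen e _) (lgenE e m).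
Qed.

End Exponents.

(** * Rank from integral relations *)

Section ClearDenominators.

Import GRing.Theory Num.Theory.
Local Open Scope ring_scope.

Lemma clear_denominators N (z : 'rV[rat]_N) :
  exists (d : rat) (z' : 'rV[int]_N), d != 0 /\ d *: z = map_mx intr z'.
Proof.
pose d : int := \prod_i denq (z 0 i).
exists d%:~R, (\row_i (numq (z 0 i) * \prod_(j | j != i) denq (z 0 j))).
split; first by rewrite intr_eq0; apply/prodf_neq0 => i _; apply: denq_neq0.
apply/rowP=> i; rewrite !mxE /d (bigD1 i) //= !intrM numqE.
by rewrite mulrC mulrA.
Qed.

(** A left kernel over the rationals is determined by its integral vectors. *)
Lemma rank_le_of_relations N k l (U : 'M[int]_(N, k)) (A : 'M[int]_(N, l)) :
  (forall z : 'rV[int]_N, z *m A = 0 -> z *m U = 0) ->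
  (\rank (map_mx intr U : 'M[rat]_(N, k)) <= l)%N.
Proof.
move=> AU; set UQ := map_mx _ U; set AQ : 'M[rat]_(N, l) := map_mx intr A.
have inj n m (B : 'M[int]_(n, m)) : map_mx (intr : int -> rat) B = 0 -> B = 0.
  move=> /matrixP B0; apply/matrixP => i j.
  by have := B0 i j; rewrite !mxE => /eqP; rewrite intr_eq0 => /eqP.
have AUQ (z : 'rV_N) : z *m AQ = 0 -> z *m UQ = 0.
  move=> zA; have [d [z' [d0 dz]]] := clear_denominators z.
  have z'A : z' *m A = 0 by apply: inj; rewrite map_mxM /= -dz -scalemxAl zA scaler0.
  apply: (can_inj (scalerK d0)); rewrite scaler0 scalemxAl dz -map_mxM AU //.
  by rewrite map_mx0.
have kAU : (kermx AQ <= kermx UQ)%MS.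
  apply/row_subP => i; apply/sub_kermxP; apply: AUQ.
  by rewrite -row_mul mulmx_ker row0.
have := mxrankS kAU; rewrite !mxrank_ker => leU.
apply: leq_trans (rank_leq_col AQ).
rewrite -(subKn (rank_leq_row UQ)) -(subKn (rank_leq_row AQ)).
exact: leq_sub2l.
Qed.

End ClearDenominators.

(** * Bounding the rank by the number of colours *)

Section RankBound.

Import GRing.Theory Num.Theory.
Local Open Scope group_scope.

Variables (V : finType) (e : rel V).
Hypotheses (e_sym : symmetric e) (e_irr : irreflexive e).
Implicit Types (v : V) (m x y : letter V) (F : {ffun letter V -> int}).

(** The number of colours used off the star of [v], minus one: the rank of the
    functions of the colour modulo constants. *)
Definition excess (T : finType) (r : letter V -> T) v : nat :=
  #|r @: off_star e v|.-1.

Local Notation based := (letter V * {set letter V})%type.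

Definition whitehead_in (H : set (out (raag e))) : {set based} :=
  [set t | `[< exists a, whitehead_for t.1 t.2 a /\ H (out_class a) >]].

(** The colour of [x] at [v] is the set of members [phi (P, v)] of [H] having
    [x] in [P]. *)
Definition side_colour (H : set (out (raag e))) v x : {set based} :=
  [set t in whitehead_in H | (t.1.1 == v) && (x \in t.2)].

Lemma in_side_colour H v x t : (t \in side_colour H v x) =
  [&& t \in whitehead_in H, t.1.1 == v & x \in t.2].
Proof. by rewrite finset.in_set. Qed.

Lemma whitehead_inP H m P :
  reflect (exists a, whitehead_for m P a /\ H (out_class a))
    ((m, P) \in whitehead_in H).
Proof. by rewrite inE; apply: asboolP. Qed.

Lemma card_dependent_pairs (I J : finType) (B : I -> {set J}) :
  #|[set p : I * J | p.2 \in B p.1]| = \sum_i #|B i|.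
Proof.
rewrite -sum1_card (eq_bigl (fun p : I * J => true && (p.2 \in B p.1))).
  rewrite -(pair_big_dep xpredT (fun i j => j \in B i) (fun _ _ => 1%N)) /=.
  by apply: eq_bigr => i _; rewrite sum1_card.
by move=> p; rewrite inE.
Qed.

Variables (H : set (out (raag e))) (k : nat) (f : 'rV[int]_k -> out (raag e)).
Hypotheses (fM : {morph f : x y / (x + y)%R >-> x * y}) (f_inj : injective f)
  (f_range : range f = H).

Let f0 : f 0%R = 1.
Proof. by apply: (mulgI (f 0%R)); rewrite -fM addr0 mulg1. Qed.

Let fN u : f (- u)%R = (f u)^-1.
Proof. by apply/esym/mulg1_eq; rewrite -fM subrr f0. Qed.

(* The exponents F are realised by an automorphism whose class is f u. *)
Let witness v (u : 'rV[int]_k) F : Prop :=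
  exists2 a, multiplies v F a & f u = out_class a.

Let witness_sum v (I : finType) (p : pred I) (z : I -> int)
    (u : I -> 'rV[int]_k) (F : I -> {ffun letter V -> int}) :
  (forall i, p i -> fixes_star e v (F i)) -> (forall i, p i -> witness v (u i) (F i)) ->
  witness v (\sum_(i | p i) u i *~ z i)%R (\sum_(i | p i) F i *~ z i)%R.
Proof.
move=> F0 uF; pose W u F := fixes_star e v F /\ witness v u F.
suff : W (\sum_(i | p i) u i *~ z i)%R (\sum_(i | p i) F i *~ z i)%R by case.
have W0 : W 0%R 0%R.
  split=> [y _|]; first by rewrite ffunE.
  by exists 1; [exact: multiplies1|rewrite f0].
have WD u1 F1 u2 F2 : W u1 F1 -> W u2 F2 -> W (u1 + u2)%R (F1 + F2)%R.
  case=> F10 [a aF ua] [F20 [b bF ub]]; split=> [y ye|].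
    by rewrite ffunE F10 // F20 // addr0.
  by exists (a * b); [exact: multipliesM|rewrite fM ua ub; exact/esym/out_classM].
have WN u1 F1 : W u1 F1 -> W (- u1)%R (- F1)%R.
  case=> F10 [a aF ua]; split=> [y ye|]; first by rewrite ffunE F10 // oppr0.
  by exists a^-1; [exact: multipliesV|rewrite fN ua; exact/esym/out_classV].
have WX u1 F1 n : W u1 F1 -> W (u1 *+ n)%R (F1 *+ n)%R.
  by move=> WF; elim: n => [|n IHn]; rewrite ?mulr0n // !mulrS; apply: WD.
elim/big_rec2: _ => [//|i F1 u1 pi W1]; apply: WD => //.
have Wi : W (u i) (F i) by split; [exact: F0|exact: uF].
by case: (z i) => n; rewrite ?NegzE ?mulrNz; try apply: WN; apply: WX.
Qed.

(** The elements of [S] span [Q^k].  If an integral combination of the exponent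
    functions based at [v] is constant off the star of [v], the corresponding
    product is inner and the same combination of vectors vanishes.  Hence the
    rank of these vectors is at most the number of linear conditions that say,
    for all [v] at once, that such a combination is constant: one for each
    colour other than a reference colour. *)
Lemma free_abelian_rank_le (S : set (out (raag e))) :
  (S `<=` @out_class (raag e) @` is_whitehead e)%classic -> H = generated S ->
  (k <= \sum_v excess (side_colour H v) v)%N.
Proof.
move=> SW HS.
pose T := whitehead_in H.
have [u uP] : exists u : based -> 'rV[int]_k, forall t, t \in T ->
    exists2 a, whitehead_for t.1 t.2 a & f (u t) = out_class a.
  suff /choice[u uP] : forall t, exists u, t \in T ->
      exists2 a, whitehead_for t.1 t.2 a & f u = out_class a by exists u.
  move=> t.
  case: (boolP (t \in T)) => [|_]; last by exists 0%R.
  case: t => m P /whitehead_inP[a [aP]]; rewrite -f_range => -[w _ wa].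
  by exists w => _; exists a.
pose N := #|{: based}|; pose tt (i : 'I_N) : based := enum_val i.
pose U : 'M[int]_(N, k) := (\matrix_(i < N) (if tt i \in T then u (tt i) else 0))%R.
pose colours v := side_colour H v @: off_star e v.
(* The reference colour at v; the default is only used when v has no colour. *)
pose c0 v := odflt finset.set0 [pick c in colours v].
pose K := [set p : V * {set based} | p.2 \in colours p.1 :\ c0 p.1].
have cardK : #|K| = \sum_v excess (side_colour H v) v.
  rewrite /K (card_dependent_pairs (fun v => colours v :\ c0 v)).
  apply: eq_bigr => v _; rewrite /excess -/(colours v) /c0.
  case: pickP => [c cv|cv] /=; first by rewrite [in RHS](cardsD1 c) cv.
  have -> : colours v = finset.set0 by apply/finset.setP => c; rewrite finset.in_set0 cv.
  by rewrite finset.set0D cards0.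
rewrite -cardK.
pose sg (t : based) : int := ((-1) ^+ t.1.2)%R.
pose A : 'M[int]_(N, #|K|) := (\matrix_(i < N, j < #|K|)
  let p : V * {set based} := enum_val j in
  if (tt i \in T) && ((tt i).1.1 == p.1)
  then sg (tt i) * ((tt i \in p.2)%:R - (tt i \in c0 p.1)%:R) else 0)%R.
apply: leq_trans (_ : (\rank (map_mx intr U : 'M[rat]_(N, k)) <= _)%N); last first.
  apply: (@rank_le_of_relations _ _ _ U A) => z zA.
  have zv v : (\sum_(i | (tt i \in T) && ((tt i).1.1 == v)) u (tt i) *~ z 0 i = 0)%R.
    pose F := (\sum_(i | (tt i \in T) && ((tt i).1.1 == v))
      exponent (tt i).1 (tt i).2 *~ z 0 i)%R.
    have [a aF ua] : witness v (\sum_(i | (tt i \in T) && ((tt i).1.1 == v))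
        u (tt i) *~ z 0 i)%R F.
      apply: witness_sum => i /andP[/uP[a aP ua] /eqP<-].
        exact: exponent_fixes_star aP.
      by exists a => //; apply: exponent_multiplies.
    apply: f_inj; rewrite f0 ua.
    apply: (multiplies_inner aF (c := (\sum_(i | (tt i \in T) && ((tt i).1.1 == v))
      sg (tt i) * (tt i \in c0 v)%:R *~ z 0 i)%R)) => y.
    rewrite /F sum_ffunE; case: ifP => [yv|/negbT yv]; last first.
      apply: big1 => i /andP[/uP[b bP _] /eqP iv].
      by rewrite ffunMzE (exponent_fixes_star bP) ?mul0rz // iv.
    have Ey i : (tt i \in T) && ((tt i).1.1 == v) ->
        (exponent (tt i).1 (tt i).2 *~ z 0 i)%R y
        = (sg (tt i) * (tt i \in side_colour H v y)%:R *~ z 0 i)%R.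
      case/andP=> iT /eqP iv; rewrite ffunMzE ffunE /moved inE -/T iT iv eqxx /=.
      move: yv; rewrite off_starE => /andP[-> _]; rewrite andbT.
      by case: (y \in _); rewrite ?mulr1 ?mulr0.
    rewrite (eq_bigr _ Ey); case: (eqVneq (side_colour H v y) (c0 v)) => [->//|yc].
    have yK : (v, side_colour H v y) \in K by rewrite inE /= !inE yc imset_f.
    set j := enum_rank_in yK (v, side_colour H v y).
    have jE : enum_val j = (v, side_colour H v y) by rewrite enum_rankK_in.
    have := congr1 (fun M : 'rV_#|K| => M 0%R j) zA.
    rewrite /= [LHS]mxE [RHS]mxE.
    have Aj i : A i j = if (tt i \in T) && ((tt i).1.1 == v)
        then (sg (tt i) * ((tt i \in side_colour H v y)%:R - (tt i \in c0 v)%:R))%R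
        else 0%R by rewrite mxE jE.
    rewrite (eq_bigr _ (fun i _ => congr1 (fun c => z 0%R i * c)%R (Aj i))).
    rewrite (bigID (fun i => (tt i \in T) && ((tt i).1.1 == v))) /=.
    rewrite [X in (_ + X)%R]big1 ?addr0; last by move=> i /negPf->; rewrite mulr0.
    move=> E; apply/eqP; rewrite -subr_eq0 -sumrB -[X in _ == X]E; apply/eqP.
    apply: eq_bigr => i ->; rewrite -mulrzBl -mulrBr.
    by rewrite -mulrzr mulrC; congr (_ * _)%R; rewrite intz.
  have -> : (z *m U = \sum_(i | tt i \in T) u (tt i) *~ z 0 i)%R.
    rewrite mulmx_sum_row [in RHS]big_mkcond /=; apply: eq_bigr => i _.
    rewrite rowK; case: ifP => _; rewrite ?scaler0 //.
    by rewrite -{1}[z 0%R i]intz scaler_int.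
  rewrite (partition_big (fun i => (tt i).1.1) xpredT) //=.
  by apply: big1 => v _; apply: zv.
(* The elements of H whose vector is in the row space form a subgroup
   containing the generators. *)
have span (w : 'rV[int]_k) : (map_mx intr w <= (map_mx intr U : 'M[rat]_(N, k)))%MS.
  pose Sp : set (out (raag e)) := fun g => exists2 w : 'rV[int]_k, f w = g &
    (map_mx intr w <= (map_mx intr U : 'M[rat]_(N, k)))%MS.
  have : Sp (f w).
    have : H (f w) by rewrite -f_range; exists w.
    rewrite HS; apply; split.
      split.
      - by exists 0%R => //; rewrite map_mx0 sub0mx.
      - move=> _ _ [w1 <- s1] [w2 <- s2]; exists (w1 + w2)%R; first exact: fM.
        by rewrite map_mxD; apply: addmx_sub.
      - move=> _ [w1 <- s1]; exists (- w1)%R; first exact: fN.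
        by rewrite map_mxN -scaleN1r; apply: scalemx_sub.
    move=> s Ss; have [a [m [P aP]] as_] := SW _ Ss.
    have tT : (m, P) \in T.
      apply/whitehead_inP; exists a; split=> //; rewrite as_ HS => B [_ SB].
      exact: SB.
    have [b bP ub] := uP _ tT.
    have ab : a = b.
      apply: aut_eqP; apply: raag_morph_eq; [exact: autM|exact: autM|].
      by move=> v; rewrite (proj2 aP) (proj2 bP).
    exists (u (m, P)); first by rewrite ub -ab.
    apply: (eq_row_sub (enum_rank (m, P))).
    by rewrite -map_row rowK /tt enum_rankK tT.
  by case=> w' /f_inj ->.
rewrite -{1}(mxrank1 rat k); apply: mxrankS; apply/row_subP => i.
have -> : row i (1%:M : 'M[rat]_k) = map_mx intr (row i (1%:M : 'M[int]_k)).
  by rewrite map_row map_mx1.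
exact: span.
Qed.

End RankBound.

(** * Coherent colourings and their transfer *)

Section Coherent.

Variables (V : finType) (e : rel V).
Hypotheses (e_sym : symmetric e) (e_irr : irreflexive e).
Implicit Types (v w m n : V) (x y : letter V).

Section Colouring.
Variables (T : finType) (r : V -> letter V -> T).

Definition active v : bool :=
  [exists x in off_star e v, exists y in off_star e v, r v x != r v y].

Lemma activeP v x y : x \in off_star e v -> y \in off_star e v ->
  r v x != r v y -> active v.
Proof.
by move=> xv yv xy; apply/existsP; exists x; rewrite xv; apply/existsP; exists y;
  rewrite yv.
Qed.

Lemma activePn v x y : ~~ active v ->
  x \in off_star e v -> y \in off_star e v -> r v x = r v y.
Proof.
by move=> vN xv yv; apply/eqP; apply: contraNT vN; apply: activeP.
Qed.

Lemma excess_inactive v : ~~ active v -> excess e (r v) v = 0.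
Proof.
move=> vN; apply/eqP; rewrite /excess -leqn0 -subn1 leq_subLR addn0.
apply/card_le1P => _ /imsetP[x xv ->] c; apply/imsetP/idP => [[y yv ->]|].
  by rewrite inE (activePn vN yv xv).
by rewrite inE => /eqP->; exists x.
Qed.

(** What the colourings of a commuting family satisfy.  The second clause says
    that, for two active non-adjacent vertices, the colours at [m] other than
    that of [n] and the colours at [n] other than that of [m] are disjoint. *)
Definition coherent : Prop :=
  (forall v x y, x \in off_star e v -> y \in off_star e v -> e x.1 y.1 ->
     r v x = r v y) /\
  (forall m n, m != n -> ~~ e m n -> active m -> active n ->
     r m (linv (pos n)) = r m (pos n) /\
     forall x, x \in off_star e m -> x \in off_star e n ->
       r m x = r m (pos n) \/ r n x = r n (pos m)).

End Colouring.

Section Transfer.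
Variables (T : finType) (r : V -> letter V -> T) (m w : V).
Hypotheses (r_coh : coherent r) (mw : m != w) (lk_mw : lk e m \subset lk e w).
Hypotheses (m_act : active r m).
Hypothesis split_w : r m (linv (pos w)) = r m (pos w).
Hypothesis nested : forall x, x \in off_star e m -> x \in off_star e w ->
  r m x != r m (pos w) -> r w x = r w (pos m).
Hypothesis together : forall n b b', active r n -> n != m -> n != w ->
  ~~ e n w -> r n (w, b) = r n (m, b').

Let lkP v : e m v -> e w v.
Proof. by move=> mv; have := fintype.subsetP lk_mw v; rewrite !inE; apply. Qed.

Let emw : e m w = false.
Proof. by apply/negP=> /lkP; rewrite e_irr. Qed.

(** The colours at [m] that are not the colour of [w] are carried over to [w],
    where they subdivide the colour of [m]; the vertex [m] becomes
    monochromatic. *)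
Definition transfer v x : T + T :=
  if v == w then
    if (x \in off_star e m) && (r m x != r m (pos w)) then inl (r m x)
    else inr (r w x)
  else if v == m then inr (r m (pos m)) else inr (r v x).

Let transfer_w x : transfer w x =
  if (x \in off_star e m) && (r m x != r m (pos w)) then inl (r m x)
  else inr (r w x).
Proof. by rewrite /transfer eqxx. Qed.

Let transfer_m x : transfer m x = inr (r m (pos m)).
Proof. by rewrite /transfer eqxx (negPf mw). Qed.

Let transfer_other v x : v != w -> v != m -> transfer v x = inr (r v x).
Proof. by rewrite /transfer => /negPf-> /negPf->. Qed.

Lemma transfer_inactive : ~~ active transfer m.
Proof.
apply/existsP=> -[x /andP[_ /existsP[y /andP[_]]]].
by rewrite !transfer_m eqxx.
Qed.

Lemma transfer_active v : v != w -> active transfer v -> active r v /\ v != m.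
Proof.
move=> vw av; have vm : v != m.
  by apply: contraTneq av => ->; apply: transfer_inactive.
split=> //; case/existsP: av => x /andP[xv /existsP[y /andP[yv]]].
rewrite !transfer_other // => xy; apply: (activeP xv yv).
by apply: contraNneq xy => ->.
Qed.

(* The only new pairs to check involve w and a vertex n that is active and not
   adjacent to w.  Such an n is not adjacent to m either, and gives m and w the
   same colour, so that the conditions for n and m and for n and w add up. *)
Let pair_w n : n != w -> ~~ e n w -> active transfer n ->
  [/\ transfer w (linv (pos n)) = transfer w (pos n),
      transfer n (linv (pos w)) = transfer n (pos w)
    & forall x, x \in off_star e w -> x \in off_star e n ->
        transfer w x = transfer w (pos n) \/ transfer n x = transfer n (pos w)].
Proof.
case: r_coh => insep pairs nw enw /(transfer_active nw)[n_act nm].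
have enm : ~~ e n m by rewrite e_sym; apply: contraNN enw => /lkP; rewrite e_sym.
have [emn mn] : ~~ e m n /\ m != n by rewrite e_sym eq_sym.
have [wn ewn] : w != n /\ ~~ e w n by rewrite e_sym eq_sym.
have [mnE mnx] := pairs _ _ mn emn m_act n_act.
have offm b : (n, b) \in off_star e m by rewrite off_starE /= nm.
have offw b : (n, b) \in off_star e w by rewrite off_starE /= nw.
split.
- rewrite !transfer_w !offm mnE; case: ifP => // _; congr inr.
  have [w_act|wN] := boolP (active r w); last exact: activePn wN (offw _) (offw _).
  by case: (pairs _ _ wn ewn w_act n_act).
- rewrite !transfer_other //; congr inr.
  by rewrite (together true false) // -(together false false).
move=> x xw xn; case: (eqVneq (r n x) (r n (pos w))) => [E|nx].
  by right; rewrite !transfer_other // E.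
left; have xm : x.1 != m.
  apply: contraNneq nx; case: x {xw xn} => u b /= ->.
  by rewrite (together false b).
have {xm} xm : x \in off_star e m.
  rewrite off_starE xm; apply: contraTN xw => /lkP ewx.
  by rewrite off_starE ewx andbF.
have rm : r m x = r m (pos n).
  case: (mnx x xm xn) => // E; case/eqP: nx.
  by rewrite E (together false false).
rewrite !transfer_w xm offm rm; case: ifP => // _; congr inr.
have [w_act|wN] := boolP (active r w); last exact: activePn wN _ (offw _).
have [_ wnx] := pairs _ _ wn ewn w_act n_act.
by case: (wnx x xw xn) => // E; case/eqP: nx.
Qed.

(** Pairs of vertices other than [w] are unaffected, and adjacent letters off
    the star of [w] are off the star of [m] as well. *)
Lemma transfer_coherent : coherent transfer.
Proof.
case: (r_coh) => insep pairs; split.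
  move=> v x y xv yv exy; have [vw|vw] := eqVneq v w; last first.
    have [->|vm] := eqVneq v m; first by rewrite !transfer_m.
    by rewrite !transfer_other // (insep _ x y).
  subst v; have offm z z' : z \in off_star e w -> z' \in off_star e w -> e z.1 z'.1 ->
      z \in off_star e m.
    rewrite !off_starE => /andP[zw ewz] /andP[z'w ewz'] ezz'.
    apply/andP; split; last by apply: contraNN ewz => /lkP.
    by apply: contraNneq ewz' => zm; apply: lkP; rewrite -zm.
  have xm : x \in off_star e m by apply: (offm x y).
  have ym : y \in off_star e m by apply: (offm y x); rewrite // e_sym.
  by rewrite !transfer_w xm ym (insep m x y) // (insep w x y).
move=> u v uv euv u_act v_act; have [uw|uw] := eqVneq u w.
  subst u; have vw : v != w by rewrite eq_sym.
  by have [|A _ C] := pair_w vw _ v_act; rewrite 1?e_sym.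
have [vw|vw] := eqVneq v w.
  subst v; have [_ B C] := pair_w uv euv u_act; split=> // x xu xv.
  by case: (C x xv xu); auto.
have [ru um] := transfer_active uw u_act; have [rv vm] := transfer_active vw v_act.
have [A C] := pairs _ _ uv euv ru rv.
rewrite !(transfer_other _ uw um) A; split=> // x xu xv.
by rewrite !(transfer_other _ uw um) !(transfer_other _ vw vm);
  case: (C x xu xv) => ->; auto.
Qed.

(** The colour of [m] at [w] survives as the colour of the letter [m], which is
    not off the star of [m] and so is never recoloured.  Thus [w] gains all the
    colours at [m] but one. *)
Lemma transfer_excess :
  \sum_v excess e (r v) v <= \sum_v excess e (transfer v) v.
Proof.
case: r_coh => insep _.
rewrite (bigD1 w) //= (bigD1 m) //= [leqRHS](bigD1 w) //= addnA leq_add //.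
  set A := r m @: off_star e m; set B := r w @: off_star e w.
  have B0 : (0 < #|B|)%N.
    apply/card_gt0P; exists (r w (pos m)); apply: imset_f.
    by rewrite off_starE /= mw e_sym emw.
  rewrite /excess -/A -/B.
  have sub : (inl @: (A :\ r m (pos w))) :|: (inr @: B) \subset transfer w @: off_star e w.
    apply/fintype.subsetP=> c /finset.setUP[] /imsetP[c'].
      rewrite !inE => /andP[cw /imsetP[x xm c'E]] ->; subst c'.
      apply/imsetP; exists x; last by rewrite transfer_w xm cw.
      rewrite off_starE; apply/andP; split.
        by apply: contraNneq cw => /letterP[->|->]; rewrite ?split_w.
      apply: contraNN cw => ewx; apply/eqP/insep => //; last by rewrite e_sym.
      by rewrite off_starE /= eq_sym mw emw.
    case/imsetP=> x xw -> ->; case: (boolP ((x \in off_star e m) && (r m x != r m (pos w)))).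
      case/andP=> xm xmw; apply/imsetP; exists (pos m).
        by rewrite off_starE /= mw e_sym emw.
      by rewrite transfer_w off_starE eqxx (nested xm xw xmw).
    by move=> /negPf xX; apply/imsetP; exists x; rewrite // transfer_w xX.
  have := subset_leq_card sub; rewrite cardsU disjoint_setI0 ?cards0 ?subn0; last first.
    rewrite -setI_eq0; apply/eqP/finset.setP=> c; rewrite finset.in_set0.
    by apply/negP; rewrite finset.in_setI => /andP[/imsetP[c1 _ ->] /imsetP[c2 _]].
  rewrite (card_imset _ (_ : injective inl)) => [|? ? []//].
  rewrite (card_imset _ (_ : injective inr)) => [|? ? []//].
  have := cardsD1 (r m (pos w)) A.
  move: #|B| B0 => [//|b] _; move: #|transfer w @: _| => [|c]; first by rewrite addnS.
  rewrite addnS ltnS => E; apply: leq_trans; rewrite addnC leq_add2r.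
  rewrite E. by case: (_ \in A); rewrite //= leq_pred.
rewrite [leqRHS](bigD1 m) //= ?mw //; apply: leq_trans (leq_addl _ _).
apply: leq_sum => v /andP[vw vm].
have E : transfer v @: off_star e v = inr @: (r v @: off_star e v).
  rewrite -imset_comp; apply: eq_imset => x; exact: transfer_other.
by rewrite /excess E (card_imset _ (_ : injective inr)) => [|? ? []].
Qed.

Lemma transfer_nonprincipal : m \notin principal e ->
  active r w || (w \in principal e) ->
  (#|[set v | (v \notin principal e) && active transfer v]|
     < #|[set v | (v \notin principal e) && active r v]|)%N.
Proof.
move=> mP wP; apply: proper_card; apply/properP; split; last first.
  exists m; first by rewrite finset.in_set mP m_act.
  by rewrite finset.in_set (negPf transfer_inactive) andbF.
apply/fintype.subsetP=> v; rewrite 2!finset.in_set => /andP[vP va]; rewrite vP /=.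
have [vw|vw] := eqVneq v w; last by have [] := transfer_active vw va.
by subst v; move: wP; rewrite (negPf vP) orbF.
Qed.

End Transfer.
End Coherent.

(** * Moving colours to principal vertices *)

Section Normalise.

Variables (V : finType) (e : rel V).
Hypotheses (e_sym : symmetric e) (e_irr : irreflexive e).
Implicit Types (v w m n : V) (x y : letter V).

Lemma principal_above m : m \notin principal e ->
  exists2 w, w \in principal e & lk e m \proper lk e w.
Proof.
rewrite finset.in_set negbK => /existsP[w0 mw0].
have [w mw wmax] := @arg_maxnP _ w0 [pred w | lk e m \proper lk e w]
  (fun w => #|lk e w|) mw0.
exists w => //; rewrite finset.in_set; apply/negP=> /existsP[w' ww'].
have := wmax w' (proper_trans mw ww').
by rewrite /= leqNgt (proper_card ww').
Qed.

Lemma lk_subset_nonadj m n : lk e m \subset lk e n -> e n m = false.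
Proof.
move=> mn; apply/negP=> nm; have := fintype.subsetP mn n.
by rewrite !inE e_sym nm e_irr => /(_ isT).
Qed.

Section Target.
Variables (T : finType) (r : V -> letter V -> T) (m : V).
Hypotheses (r_coh : coherent e r) (m_act : active e r m).

(** A vertex of [lk m] outside [lk n] is adjacent to both [m] and [w]. *)
Lemma same_colour_of_link n w b b' : lk e m \subset lk e w ->
  ~~ (lk e m \subset lk e n) -> n != m -> n != w -> ~~ e n w ->
  r n (w, b) = r n (m, b').
Proof.
case: r_coh => insep _ mw mn nm nw enw.
case/subsetPn: mn => u; rewrite !inE => mu nu.
have wu : e w u by have := fintype.subsetP mw u; rewrite !inE; apply.
have un : u != n.
  by apply: contraNneq enw => <-; rewrite e_sym.
have enm : ~~ e n m.
  apply: contraNN enw => nm'; have := fintype.subsetP mw n.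
  by rewrite !inE ![e _ n]e_sym; apply.
have uo : pos u \in off_star e n by rewrite off_starE /= un.
rewrite -(insep n (pos u) (w, b) uo) ?off_starE /= ?[w == _]eq_sym ?nw // 1?e_sym //.
by rewrite -(insep n (pos u) (m, b') uo) ?off_starE /= ?[m == _]eq_sym ?nm // 1?e_sym.
Qed.

(** The letters that [n] separates from [m]. *)
Definition far n : {set letter V} := [set x in off_star e n | r n x != r n (pos m)].

Lemma in_far n x :
  (x \in far n) = (x \in off_star e n) && (r n x != r n (pos m)).
Proof. by rewrite finset.in_set. Qed.

(** If [n] separates [w] from [m], then [m] and [n] have the same colour at [w];
    so the letters beyond [w] are also beyond [n], together with [w] itself. *)
Lemma far_increases n w b b' : active e r n -> active e r w ->
  lk e m \subset lk e w -> n != m -> w != m -> n != w -> ~~ e n w ->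
  lk e m \subset lk e n -> r n (w, b) != r n (m, b') -> far w \proper far n.
Proof.
case: r_coh => insep pairs n_act w_act mw nm wm nw enw mn.
have [wn mn'] : w != n /\ m != n by rewrite ![_ == n]eq_sym.
have ewn : ~~ e w n by rewrite e_sym.
have enm : ~~ e n m by rewrite (lk_subset_nonadj mn).
have ewm : ~~ e w m by rewrite (lk_subset_nonadj mw).
have emn : ~~ e m n by rewrite e_sym.
have [nwE nwx] := pairs _ _ nw enw n_act w_act.
have [wnE wnx] := pairs _ _ wn ewn w_act n_act.
have [nmE _] := pairs _ _ nm enm n_act m_act.
have two u c : r n (linv (pos u)) = r n (pos u) -> r n (u, c) = r n (pos u).
  by case: c.
rewrite (two w b) // (two m b') // => sep.
have mo u : u != m -> ~~ e u m -> pos m \in off_star e u.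
  by move=> um eum; rewrite off_starE /= eq_sym um.
have wE : r w (pos m) = r w (pos n).
  case: (wnx (pos m)); rewrite ?mo // => E.
  by rewrite E eqxx in sep.
have wo : pos w \in off_star e n by rewrite off_starE /= wn.
apply/properP; split; last first.
  by exists (pos w); rewrite in_far ?wo // off_starE eqxx.
apply/fintype.subsetP=> x; rewrite !in_far wE => /andP[xw xE].
have xn : x \in off_star e n.
  rewrite off_starE; apply/andP; split.
    by apply: contraNneq xE => /letterP[->|->]; rewrite ?wnE.
  apply: contraNN xE => enx; apply/eqP/insep => //; last by rewrite e_sym.
  by rewrite off_starE /= nw.
rewrite xn /=; case: (wnx x xw xn) => E; first by rewrite E eqxx in xE.
by rewrite E.
Qed.

(** Among the active vertices whose link contains [lk m], one with the most
    letters beyond it has no other between it and [m].  If there are none, every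
    vertex that can separate lacks part of [lk m], and any principal vertex with
    a larger link will do. *)
Lemma transfer_target : m \notin principal e ->
  exists w, [/\ m != w, lk e m \subset lk e w,
    active e r w || (w \in principal e) &
    [/\ r m (linv (pos w)) = r m (pos w),
        forall x, x \in off_star e m -> x \in off_star e w ->
          r m x != r m (pos w) -> r w x = r w (pos m) &
        forall n b b', active e r n -> n != m -> n != w -> ~~ e n w ->
          r n (w, b) = r n (m, b')]].
Proof.
case: r_coh => insep pairs mP.
pose above n := [&& active e r n, n != m & lk e m \subset lk e n].
case: (pickP above) => [n0 n0P|none].
  have [w /and3P[w_act wm mw] wmax] := @arg_maxnP _ n0 above (fun n => #|far n|) n0P.
  have ewm : ~~ e w m by rewrite (lk_subset_nonadj mw).
  have mw' : m != w by rewrite eq_sym.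
  have emw : ~~ e m w by rewrite e_sym.
  have [E pw] := pairs _ _ mw' emw m_act w_act.
  exists w; rewrite mw' mw w_act; split=> //; split=> //.
    by move=> x xm xw xE; case: (pw x xm xw) => // xE'; rewrite xE' eqxx in xE.
  move=> n b b' n_act nm nw enw.
  have [mn|mn] := boolP (lk e m \subset lk e n); last exact: same_colour_of_link.
  apply/eqP/negPn/negP => sep.
  have /proper_card := far_increases n_act w_act mw nm wm nw enw mn sep.
  have := wmax n; rewrite /above n_act nm mn /= => /(_ isT).
  by rewrite leqNgt => /negPf->.
have [w wP mw] := principal_above mP.
have mw' : m != w by apply: contraTneq mw => ->; rewrite fintype.properxx.
have smw := proper_sub mw.
have ewm : ~~ e w m by rewrite (lk_subset_nonadj smw).
exists w; rewrite mw' smw wP orbT; split=> //; split.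
- case/properP: mw => _ [u]; rewrite !inE => wu mu.
  have um : u != m by apply: contraNneq ewm => <-.
  have uo : pos u \in off_star e m by rewrite off_starE /= um.
  have wo b : (w, b) \in off_star e m by rewrite off_starE /= eq_sym mw' e_sym.
  have E b : r m (w, b) = r m (pos u) by apply: insep.
  exact: etrans (E true) (esym (E false)).
- move=> x xm xw _; apply: (activePn _ xw); last by rewrite off_starE /= mw'.
  by have := none w; rewrite /above eq_sym mw' smw !andbT => ->.
move=> n b b' n_act nm nw enw; apply: same_colour_of_link => //.
by have := none n; rewrite /above n_act nm /= => ->.
Qed.

End Target.

Lemma make_principal (T : finType) (r : V -> letter V -> T) : coherent e r ->
  exists (T' : finType) (r' : V -> letter V -> T'),
    [/\ coherent e r', forall v, active e r' v -> v \in principal e &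
      \sum_v excess e (r v) v <= \sum_v excess e (r' v) v].
Proof.
have [k] := ubnP #|[set v | (v \notin principal e) && active e r v]|.
elim: k T r => // k IH T r rk r_coh.
case: (pickP [pred v | (v \notin principal e) && active e r v]) => [m|none].
  move=> /andP[mP m_act].
  have [w [mw smw wP [A B C]]] := transfer_target r_coh m_act mP.
  have coh' : coherent e (transfer e r m w) by apply: transfer_coherent.
  have [|T' [r' [c' p' le']]] := IH _ (transfer e r m w) _ coh'.
    by rewrite -ltnS; apply: leq_trans rk; rewrite ltnS; apply: transfer_nonprincipal.
  exists T', r'; split=> //; apply: leq_trans le'.
  exact: transfer_excess.
exists T, r; split=> // v va; have := none v; rewrite /= va andbT.
by move/negbFE.
Qed.

End Normalise.

(** * Colours of a commuting family *)

Section SideColours.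

Variables (V : finType) (e : rel V).
Hypotheses (e_sym : symmetric e) (e_irr : irreflexive e).
Variable H : set (out (raag e)).
Hypothesis H_abelian : forall g h, H g -> H h -> commute g h.
Implicit Types (v m n : V) (x y : letter V).

Lemma side_colour_neq v x y :
  side_colour H v x != side_colour H v y ->
  exists b P, ((v, b), P) \in whitehead_in H /\ (x \in P) != (y \in P).
Proof.
move=> xy; have [t tP] : exists t, (t \in side_colour H v x) != (t \in side_colour H v y).
  apply/existsP; apply: contraNT xy; rewrite negb_exists => /forallP E.
  by apply/eqP/finset.setP=> t; apply/eqP; have := E t; rewrite negbK.
move: tP; rewrite !in_side_colour; case: t => -[u b] P /=.
case: (boolP (_ \in whitehead_in H)) => //= tW.
by case: (u =P v) tW => //= -> tW xyP; exists b, P.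
Qed.

Lemma side_colour_eq v x y :
  (forall b P a, whitehead_for (v, b) P a -> H (out_class a) -> (x \in P) = (y \in P)) ->
  side_colour H v x = side_colour H v y.
Proof.
move=> xy; apply/eqP; apply: contraT.
move=> /side_colour_neq[b [P [/whitehead_inP[a [aP Ha]]]]].
by rewrite (xy b P a) // eqxx.
Qed.

Lemma off_star_sides m (b : bool) (P : {set letter V}) x y :
  x \in off_star e m -> y \in off_star e m ->
  (x \in P) != (y \in P) -> splits e (m, b) P.
Proof.
move=> xm ym xy; apply/existsP; exists x; rewrite xm /=.
by apply/existsP; exists y; rewrite ym.
Qed.

Lemma side_colour_coherent : coherent e (side_colour H).
Proof.
split=> [v x y xv yv exy|m n mn emn m_act n_act].
  apply: side_colour_eq => b P a [GWP _] _.
  exact: (GW_subset_same_side e_sym e_irr GWP).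
have wit v : active e (side_colour H) v -> exists b P a,
    [/\ whitehead_for (v, b) P a, H (out_class a) & splits e (v, b) P].
  case/existsP=> x /andP[xv /existsP[y /andP[yv]]].
  move=> /side_colour_neq[b [P [/whitehead_inP[a [aP Ha]]] xyP]].
  by exists b, P, a; split=> //; apply: off_star_sides xyP.
have no c : (n, c) \in off_star e m by rewrite off_starE /= eq_sym mn.
have mo c : (m, c) \in off_star e n by rewrite off_starE /= mn e_sym.
have sides b P a b' Q a' : whitehead_for (m, b) P a -> H (out_class a) ->
    splits e (m, b) P -> whitehead_for (n, b') Q a' -> H (out_class a') ->
    splits e (n, b') Q ->
    (linv (pos n) \in P) = (pos n \in P) /\ forall x, x \in off_star e m ->
      x \in off_star e n -> (x \in P) = (pos n \in P) \/ (x \in Q) = (pos m \in Q).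
  move=> aP Ha sP aQ Ha' sQ.
  have [|||nP mQ E] := commuting_sides e_sym e_irr aP aQ _ _ _ sP sQ => //.
    exact: H_abelian.
  have nPE : ((n, b') \in P) = (pos n \in P) by case: (b') nP.
  have mQE : ((m, b) \in Q) = (pos m \in Q) by case: (b) mQ.
  split; last by rewrite -nPE -mQE.
  by case: (b') nP.
split.
  apply: side_colour_eq => b P a aP Ha.
  have [sP|/splitsPn sP] := boolP (splits e (m, b) P); last exact: sP (no _) (no _).
  have [b' [Q [a' [aQ Ha' sQ]]]] := wit n n_act.
  by case: (sides _ _ _ _ _ _ aP Ha sP aQ Ha' sQ).
move=> x xm xn; have [->|] := eqVneq (side_colour H m x) (side_colour H m (pos n)).
  by left.
move=> /side_colour_neq[b [P [/whitehead_inP[a [aP Ha]]] xnP]].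
right; apply: side_colour_eq => b' Q a' aQ Ha'.
have [sQ|/splitsPn sQ] := boolP (splits e (n, b') Q); last exact: sQ (mo _).
have sP : splits e (m, b) P := off_star_sides _ xm (no _) xnP.
have [_ E] := sides _ _ _ _ _ _ aP Ha sP aQ Ha' sQ.
by case: (E x xm xn) => // xE; rewrite xE eqxx in xnP.
Qed.

End SideColours.

(** * Vertices with the same star *)

Section StarClasses.

Variables (V : finType) (e : rel V).
Hypotheses (e_sym : symmetric e) (e_irr : irreflexive e).
Implicit Types (v w m n : V) (x y : letter V).

Lemma off_star_st v w : st e v = st e w -> off_star e v = off_star e w.
Proof. by rewrite /off_star => ->. Qed.

Lemma off_star_sym v w b c : ((v, b) \in off_star e w) = ((w, c) \in off_star e v).
Proof. by rewrite !off_starE /= eq_sym e_sym. Qed.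

Lemma same_star_adj v w : st e v = st e w -> v != w -> e v w.
Proof.
move=> vw neq; have : w \in st e v by rewrite vw !inE eqxx.
by rewrite !inE eq_sym (negPf neq).
Qed.

Variables (T : finType) (r : V -> letter V -> T).
Hypothesis r_coh : coherent e r.

(** The common refinement of the colourings at all vertices with the star of
    [v]. *)
Definition star_colour v x : {ffun V -> option T} :=
  [ffun w => if st e w == st e v then Some (r w x) else None].

Lemma star_colour_st v w : st e v = st e w -> star_colour v =1 star_colour w.
Proof. by move=> vw x; apply/ffunP=> u; rewrite !ffunE vw. Qed.

Lemma star_colour_eq v x y :
  (forall w, st e w = st e v -> r w x = r w y) -> star_colour v x = star_colour v y.
Proof.
by move=> E; apply/ffunP=> w; rewrite !ffunE; case: eqP => // /E->.
Qed.

Lemma star_colour_neq v x y : star_colour v x != star_colour v y ->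
  exists2 w, st e w = st e v & r w x != r w y.
Proof.
move=> xy; suff /existsP[w /andP[/eqP]] : [exists w, (st e w == st e v) && (r w x != r w y)].
  by exists w.
apply: contraNT xy; rewrite negb_exists => /forallP E.
apply/eqP/star_colour_eq => w wv; apply/eqP.
by have := E w; rewrite wv eqxx negbK.
Qed.

Lemma star_colour_excess v : excess e (r v) v <= excess e (star_colour v) v.
Proof.
have SI : injective (@Some T) by move=> ? ? [].
rewrite /excess -!subn1 leq_sub2r // -(card_imset _ SI) -imset_comp.
rewrite (_ : _ @: _ = (fun c : {ffun V -> option T} => c v)
    @: (star_colour v @: off_star e v)); first exact: leq_imset_card.
by rewrite -imset_comp; apply: eq_imset => x; rewrite /= ffunE eqxx.
Qed.

(** A vertex [n'] with the star of [n] is adjacent to [n] if different from it,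
    so every vertex not adjacent to them gives both the same colour. *)
Lemma star_colour_coherent : coherent e star_colour.
Proof.
case: (r_coh) => insep pairs; split=> [v x y xv yv exy|m n mn emn m_act n_act].
  by apply: star_colour_eq => w wv; apply: insep; rewrite ?(off_star_st wv).
have no c : (n, c) \in off_star e m by rewrite off_starE /= eq_sym mn.
have act v : active e star_colour v -> exists2 w, st e w = st e v & active e r w.
  case/existsP=> x /andP[xv /existsP[y /andP[yv]]] /star_colour_neq[w wv xy].
  by exists w; rewrite // (activeP _ _ xy) // (off_star_st wv).
have move_n m' n' n'' b : pos n' \in off_star e m' -> st e n'' = st e n' ->
    n'' != n' -> r m' (n', b) = r m' (pos n'').
  move=> n'm' st_n nn; apply: insep.
  - by rewrite off_starE; move: n'm'; rewrite off_starE.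
  - by rewrite (off_star_sym _ _ _ false) (off_star_st st_n) (off_star_sym _ _ _ false).
  - by rewrite /= e_sym same_star_adj.
have nm m' n' c : st e m' = st e m -> st e n' = st e n -> (n', c) \in off_star e m'.
  move=> mm nn; rewrite (off_star_st mm) (off_star_sym _ _ _ false) (off_star_st nn).
  by rewrite (off_star_sym _ _ _ c).
have nn_adj m' n' : pos n' \in off_star e m' -> m' != n' /\ ~~ e m' n'.
  by rewrite off_starE /= eq_sym => /andP.
split.
  apply: star_colour_eq => m' mm.
  have [m'_act|m'N] := boolP (active e r m'); last by apply: (activePn m'N); apply: nm.
  have [n' nn n'_act] := act n n_act.
  have [E|n'n] := eqVneq n' n.
    subst n'; have [? ?] := nn_adj m' n (nm _ _ _ mm erefl).
    by case: (pairs m' n).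
  have pn : pos n \in off_star e m' by apply: nm.
  exact: etrans (move_n _ _ _ true pn nn n'n) (esym (move_n _ _ _ false pn nn n'n)).
move=> x xm xn; have [->|] := eqVneq (star_colour m x) (star_colour m (pos n)).
  by left.
case/star_colour_neq=> m' mm xn'; right; apply: star_colour_eq => n' nn.
have xm' : x \in off_star e m' by rewrite (off_star_st mm).
have m'_act : active e r m' by apply: (activeP _ _ xn') => //; apply: nm.
have xn'' : x \in off_star e n' by rewrite (off_star_st nn).
have mn' c m'' : st e m'' = st e m -> (m'', c) \in off_star e n'.
  by move=> mm'; rewrite (off_star_sym _ _ _ c); apply: nm.
have [n'_act|n'N] := boolP (active e r n'); last by apply: (activePn n'N) => //; apply: mn'.
have [m'n' em'n'] := nn_adj m' n' (nm _ _ _ mm nn).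
have [_ E] := pairs m' n' m'n' em'n' m'_act n'_act.
have En : r m' (pos n') = r m' (pos n).
  have [->//|n'n] := eqVneq n' n.
  by apply/esym/move_n => //; apply: nm.
have Em : r n' (pos m') = r n' (pos m).
  have [->//|m'm] := eqVneq m' m.
  by apply/esym/move_n => //; apply: mn'.
case: (E x xm' xn'') => xE; last by rewrite xE.
by rewrite xE En eqxx in xn'.
Qed.

End StarClasses.

(** * Unions of inseparable sets *)

Section Components.

Variables (V : finType) (e : rel V).
Hypotheses (e_sym : symmetric e) (e_irr : irreflexive e).
Variables (v : V) (P : {set letter V}).
Hypothesis P_adj : forall x y, x \in off_star e v -> y \in off_star e v ->
  e x.1 y.1 -> (x \in P) = (y \in P).

Let W := ~: lk e v.
Let adj := [rel a b | [&& a \in W, b \in W & e a b]].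

Let adj_off u w : u != v -> adj u w -> (w != v) && ~~ e v w.
Proof.
move=> uv /and3P[uW wW uw]; apply/andP; split; last by rewrite !inE in wW.
by apply: contraTneq uw => ->; rewrite !inE in uW; rewrite e_sym.
Qed.

(* Since u and w differ the path has an edge, which makes the signs b and c
   irrelevant. *)
Let connect_side u w b c : (u, b) \in off_star e v -> connect adj u w -> u != w ->
  (w, c) \in off_star e v /\ ((u, b) \in P) = ((w, c) \in P).
Proof.
move=> uo /connectP[p]; elim: p u b uo => [|t p IH] u b uo /=.
  by move=> _ ->; rewrite eqxx.
case/andP=> ut tp wE uw.
have to d : (t, d) \in off_star e v.
  by rewrite off_starE; apply: adj_off ut; move: uo; rewrite off_starE => /andP[].
have utP d : ((u, b) \in P) = ((t, d) \in P).
  by apply: P_adj => //; case/and3P: ut.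
have [tw|tw] := eqVneq t w; first by rewrite -tw.
by rewrite (utP b); apply: IH.
Qed.

(** In the complement of [lk v] the vertex [v] is isolated, so the components
    are [v] alone and the components off the star.  Membership in [P] propagates
    along the edges of the latter, and also from a letter to its inverse by way
    of a neighbour, unless the component is a single vertex. *)
Lemma GW_subset_of_adj (b : bool) :
  {subset P <= off_star e v} -> GW_subset e (v, b) ((v, b) |: P).
Proof.
move=> Po; pose I := [set U in inseparable e (v, b) | U \subset (v, b) |: P].
have comp u : u \in W -> [set y in W | connect adj u y] \in components e W.
  by move=> uW; apply: imset_f.
have inI U : (U \in I) = (U \in inseparable e (v, b)) && (U \subset (v, b) |: P).
  by rewrite finset.in_set.
have in_insep U : (U \in inseparable e (v, b)) = [exists C in components e W,
    [exists u, (C == [set u.1]) && (U == [set u])] || ((1 < #|C|)%N && (U == pm C))].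
  by rewrite finset.in_set.
have vW : v \in W by rewrite !inE e_irr.
apply/and3P; split; last first.
- apply: contraT; rewrite negbK in_setU1 => /orP[/eqP[]|/Po]; first by case: (b).
  by rewrite off_starE eqxx.
- by rewrite setU11.
apply/existsP; exists I; apply/andP; split.
  by apply/fintype.subsetP=> U; rewrite inI => /andP[].
rewrite finset.eqEsubset; apply/andP; split; last first.
  by apply/bigcupsP=> U; rewrite inI => /andP[].
have singleton x C : C \in components e W -> C = [set x.1] -> x \in (v, b) |: P ->
    x \in finset.cover I.
  move=> CW Cx xP; apply/finset.bigcupP; exists [set x]; last exact: set11.
  rewrite inI finset.sub1set xP andbT in_insep; apply/existsP; exists C; rewrite CW /=.
  by apply/orP; left; apply/existsP; exists x; rewrite Cx !eqxx.
apply/fintype.subsetP=> x xP; case/setU1P: (xP) => [xv|xP'].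
  apply: (singleton x [set y in W | connect adj v y]) => //; first exact: comp.
  apply/finset.setP=> y; rewrite xv finset.in_set finset.in_set1 /=.
  apply/andP/eqP=> [[_ /connectP[[|t p] /=]]|->]; first by [].
    by case/andP=> /and3P[_ tW vt]; move: tW; rewrite !inE vt.
  by split=> //; apply: connect0.
have xo := Po x xP'; have [xv exv] : x.1 != v /\ ~~ e v x.1.
  by apply/andP; rewrite -off_starE.
have xW : x.1 \in W by rewrite !inE.
pose C := [set y in W | connect adj x.1 y].
have CW : C \in components e W by apply: comp.
have xC : x.1 \in C by rewrite finset.in_set xW connect0.
have [C1|] := leqP #|C| 1.
  by apply: (singleton x C) => //; apply/eqP; rewrite eq_sym eqEcard finset.sub1set xC cards1.
move=> C1; apply/finset.bigcupP; exists (pm C); last by rewrite inE.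
rewrite inI; apply/andP; split.
  by rewrite in_insep; apply/existsP; exists C; rewrite CW C1 eqxx orbT.
have xE : (x.1, x.2) = x by case: (x).
have far y : y.1 \in C -> x.1 != y.1 -> (x \in P) = (y \in P).
  rewrite finset.in_set => /andP[_ xy] neq.
  have xo' : (x.1, x.2) \in off_star e v by rewrite xE.
  by have [_] := connect_side y.2 xo' xy neq; rewrite xE; case: (y).
apply/fintype.subsetP=> y; rewrite finset.in_set => yC; rewrite in_setU1; apply/orP; right.
have [xy|xy] := eqVneq x.1 y.1; last by rewrite -(far y).
have [u uC ux] : exists2 u, u \in C & u != x.1.
  case/card_gt1P: C1 => u [w [uC wC uw]].
  have [ux|] := eqVneq u x.1; last by exists u.
  by exists w; rewrite // -ux eq_sym.
have yo : y \in off_star e v by move: xo; rewrite !off_starE xy.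
have yE : (y.1, y.2) = y by case: (y).
have xu : ((x \in P) = ((u, true) \in P)) by apply: far; rewrite //= eq_sym.
have yo' : (y.1, y.2) \in off_star e v by rewrite yE.
have yu : connect adj y.1 u.
  by rewrite -xy; move: uC; rewrite finset.in_set => /andP[].
have [|_] := connect_side true yo' yu; first by rewrite -xy eq_sym.
by rewrite yE => ->; rewrite -xu.
Qed.

End Components.

(** * Compatible collections from coherent colourings *)

Section Blocks.

Variables (V : finType) (e : rel V).
Hypotheses (e_sym : symmetric e) (e_irr : irreflexive e).
Implicit Types (v w m n : V) (x y : letter V).
Variables (T : finType) (r : V -> letter V -> T).
Hypotheses (r_coh : coherent e r)
  (r_st : forall v w, st e v = st e w -> r v =1 r w).

Definition palette v : {set T} := r v @: off_star e v.
Definition colour_rank v x : nat := index (r v x) (enum (palette v)).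
(** All colours but the first, each of which cuts the list of colours in two
    nonempty parts. *)
Definition tops v : {set T} := [set c in palette v | 0 < index c (enum (palette v))].
Definition block v (c : T) : {set letter V} :=
  pos v |: [set x in off_star e v | colour_rank v x < index c (enum (palette v))].
Definition coblock v (c : T) : {set letter V} :=
  linv (pos v) |: [set x in off_star e v | index c (enum (palette v)) <= colour_rank v x].
Definition block_partition v c : {set {set letter V}} :=
  [set block v c; coblock v c; pm (lk e v)].

Lemma in_block v c x : (x \in block v c) =
  (x == pos v) || (x \in off_star e v) && (colour_rank v x < index c (enum (palette v))).
Proof. by rewrite in_setU1 finset.in_set. Qed.

Lemma in_coblock v c x : (x \in coblock v c) =
  (x == linv (pos v)) ||
  (x \in off_star e v) && (index c (enum (palette v)) <= colour_rank v x).
Proof. by rewrite in_setU1 finset.in_set. Qed.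

Lemma card_tops v : #|tops v| = excess e (r v) v.
Proof.
rewrite /excess -/(palette v) /tops; case E: (enum (palette v)) => [|c l].
  have -> : palette v = finset.set0 by apply/eqP; rewrite -cards_eq0 cardE E.
  by rewrite cards0; apply: eq_card0 => c; rewrite finset.in_set finset.in_set0.
have cP : c \in palette v by rewrite -mem_enum E mem_head.
rewrite (cardsD1 c (palette v)) cP /=; apply: eq_card => d.
rewrite finset.in_set finset.in_setD1 andbC; congr (_ && _).
by rewrite /= eq_sym; case: eqP.
Qed.

Lemma colour_rank_hit v c : c \in palette v -> exists2 x, x \in off_star e v &
  colour_rank v x = index c (enum (palette v)).
Proof. by case/imsetP=> x xv ->; exists x. Qed.

Lemma colour_rank0_hit v c : c \in palette v -> exists2 x,
  x \in off_star e v & colour_rank v x = 0.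
Proof.
move=> cP; have : c \in enum (palette v) by rewrite mem_enum.
case E: (enum (palette v)) => [//|d l] _.
have /imsetP[x xv dE] : d \in palette v by rewrite -mem_enum E mem_head.
by exists x; rewrite // /colour_rank E -dE /= eqxx.
Qed.

Lemma topsP v c : c \in tops v ->
  c \in palette v /\ (0 < index c (enum (palette v)))%N.
Proof. by rewrite finset.in_set => /andP. Qed.

Lemma tops_active v c : c \in tops v -> active e r v.
Proof.
case/topsP=> cP c0; have [x xv xE] := colour_rank_hit cP; have [y yv yE] := colour_rank0_hit cP.
apply: (activeP xv yv); apply: contraTneq c0 => E.
by rewrite -xE /colour_rank E -/(colour_rank v y) yE.
Qed.

Lemma colour_rank_eq v x y : r v x = r v y -> colour_rank v x = colour_rank v y.
Proof. by rewrite /colour_rank => ->. Qed.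

Lemma costar_block v c : costar e (pos v) (block v c) = coblock v c.
Proof.
apply/finset.setP=> x.
have lkE : (x \in ~: pm (lk e v)) = ~~ e v x.1 by rewrite !inE.
rewrite in_coblock finset.in_setD lkE in_block off_starE.
have [xv|xv] /= := eqVneq x.1 v; last first.
  have xN y : y.1 = v -> (x == y) = false.
    by move=> yv; apply: contra_neqF xv => /eqP->.
  by rewrite !xN //= [in RHS]leqNgt; case: (e v x.1); rewrite ?andbF ?andbT.
by case/letterP: xv => ->; rewrite /= e_irr !xpair_eqE !eqxx.
Qed.

Lemma block_GW v c : GW_subset e (pos v) (block v c).
Proof.
apply: (GW_subset_of_adj e_sym e_irr) => [x y xv yv exy|x].
  rewrite finset.in_set [in RHS]finset.in_set xv yv.
  by rewrite (colour_rank_eq ((proj1 r_coh) v x y xv yv exy)).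
by rewrite finset.in_set => /andP[].
Qed.

Lemma block_partitionP v c : c \in tops v ->
  GW_partition_of e (pos v) (block v c) (block_partition v c).
Proof.
case/topsP=> cP c0; have [x xv xE] := colour_rank_hit cP; have [y yv yE] := colour_rank0_hit cP.
have neq z b : z \in off_star e v -> z != (v, b).
  by apply: contraTneq => ->; rewrite off_starE eqxx.
apply/and4P; split; first exact: block_GW.
- apply/card_gt1P; exists (pos v), y; split; rewrite ?in_block ?eqxx ?yv ?yE ?c0 ?orbT //.
  by rewrite eq_sym neq.
- rewrite costar_block; apply/card_gt1P; exists (linv (pos v)), x.
  split; rewrite ?in_coblock ?eqxx ?xv ?xE ?leqnn ?orbT //.
  by rewrite eq_sym neq.
by rewrite costar_block.
Qed.

Lemma block_partition_based v c : c \in tops v -> based_at e (block_partition v c) v.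
Proof.
move=> cv; apply/existsP; exists (pos v); apply/existsP; exists (block v c).
by rewrite eqxx block_partitionP.
Qed.

Lemma block_compatible v w c d : c \in tops v -> d \in tops w ->
  (exists A B, [/\ A \in [set block v c; coblock v c], B \in [set block w d; coblock w d]
     & A :&: B = finset.set0]) \/ (e v w /\ st e v != st e w) ->
  compatible e (block_partition v c) (block_partition w d).
Proof.
move=> cv dw vw; apply/existsP; exists (pos v); apply/existsP; exists (block v c).
apply/existsP; exists (pos w); apply/existsP; exists (block w d).
rewrite !block_partitionP //= !costar_block; apply/orP.
case: vw => [[A [B [Av Bw AB]]]|[evw stvw]].
  left; apply/existsP; exists A; rewrite Av /=; apply/existsP; exists B.
  by rewrite Bw AB eqxx.
by right; rewrite /commutes /= evw orbT.
Qed.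

(** In each partition take the side that misses the base of the other.  Its
    letters have another colour than that base, so coherence makes the two
    sides disjoint. *)
Lemma blocks_separated v w c d : v != w -> ~~ e v w -> c \in tops v -> d \in tops w ->
  exists A B, [/\ A \in [set block v c; coblock v c], B \in [set block w d; coblock w d]
     & A :&: B = finset.set0].
Proof.
move=> vw evw cv dw; case: r_coh => insep pairs.
have [wv ewv] : w != v /\ ~~ e w v by rewrite eq_sym e_sym.
have [vwE vwx] := pairs _ _ vw evw (tops_active cv) (tops_active dw).
have [wvE _] := pairs _ _ wv ewv (tops_active dw) (tops_active cv).
have side u u' c' : u != u' -> ~~ e u u' -> r u (linv (pos u')) = r u (pos u') ->
  exists2 A, A \in [set block u c'; coblock u c'] &
   forall x, x \in A -> (x.1 == u) || [&& x \in off_star e u & r u x != r u (pos u')].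
  move=> uu' euu' E; have [lt|le] := ltnP (colour_rank u (pos u')) (index c' (enum (palette u))).
    exists (coblock u c'); first by rewrite !inE eqxx orbT.
    move=> x; rewrite in_coblock => /orP[/eqP->|/andP[xu cx]]; first by rewrite eqxx.
    rewrite xu; apply/orP; right; apply: contraTneq cx => /colour_rank_eq->.
    by rewrite -ltnNge.
  exists (block u c'); first by rewrite !inE eqxx.
  move=> x; rewrite in_block => /orP[/eqP->|/andP[xu cx]]; first by rewrite eqxx.
  rewrite xu; apply/orP; right; apply: contraTneq cx => /colour_rank_eq->.
  by rewrite -leqNgt.
have [A Av Ax] := side v w c vw evw vwE; have [B Bw Bx] := side w v d wv ewv wvE.
exists A, B; split=> //; apply/finset.setP=> x; rewrite finset.in_setI finset.in_set0.
apply/negP=> /andP[/Ax xA /Bx xB].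
case/orP: xA => [/eqP xv|/andP[xv xvw]].
  move: xB; rewrite xv (negPf vw) /= => /andP[_].
  by case/letterP: xv => ->; rewrite ?wvE eqxx.
case/orP: xB => [/eqP xw|/andP[xw xwv]].
  by move: xvw; case/letterP: xw => ->; rewrite ?vwE eqxx.
by case: (vwx x xv xw) => E; rewrite E eqxx in xvw xwv.
Qed.

Lemma palette_st v w : st e v = st e w -> palette v = palette w.
Proof.
by move=> vw; rewrite /palette (off_star_st vw); apply: eq_imset; apply: r_st.
Qed.

(** Both chains cut the same list of colours. *)
Lemma blocks_nested v w c d : st e v = st e w ->
  exists A B, [/\ A \in [set block v c; coblock v c], B \in [set block w d; coblock w d]
     & A :&: B = finset.set0].
Proof.
move=> vw.
have disj u u' c' d' : st e u = st e u' ->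
    (index c' (enum (palette u)) <= index d' (enum (palette u)))%N ->
    block u c' :&: coblock u' d' = finset.set0.
  move=> uu' cd; apply/finset.setP=> x; rewrite finset.in_setI finset.in_set0.
  rewrite in_block in_coblock /colour_rank -(palette_st uu') -(off_star_st uu') -(r_st uu').
  apply/negP=> /andP[/orP[/eqP->|/andP[xu xc]]].
    by rewrite xpair_eqE andbF off_starE eqxx.
  case/orP=> [/eqP xu'|/andP[_ dx]].
    by move: xu; rewrite xu' (off_star_st uu') off_starE eqxx.
  by have := leq_trans xc (leq_trans cd dx); rewrite ltnn.
have [cd|/ltnW dc] := leqP (index c (enum (palette v))) (index d (enum (palette v))).
  by exists (block v c), (coblock w d); rewrite !inE !eqxx orbT; split=> //; apply: disj.
exists (coblock v c), (block w d); rewrite !inE !eqxx orbT; split=> //.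
by rewrite finset.setIC; apply: disj; rewrite -?(palette_st vw).
Qed.

(** A partition coming from [w] does not separate any other vertex [v] from its
    inverse, so the base can be read off the partition. *)
Lemma block_partition_inj v w c d : c \in tops v -> d \in tops w ->
  block_partition v c = block_partition w d -> (v, c) = (w, d).
Proof.
move=> cv dw E.
have bE : [\/ block v c = block w d, block v c = coblock w d
    | block v c = pm (lk e w)].
  have : block v c \in block_partition w d by rewrite -E !inE eqxx.
  by rewrite !inE -orbA => /or3P[]/eqP; constructor.
have pv : pos v \in block v c by rewrite in_block eqxx.
have nv : linv (pos v) \notin block v c.
  by rewrite in_block xpair_eqE andbF off_starE eqxx.
have vw : v = w.
  apply/eqP; apply: contraNT nv => vw.
  have same : colour_rank w (linv (pos v)) = colour_rank w (pos v) \/ e w v.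
    case: r_coh => insep pairs; have [|ewv] := boolP (e w v); [by right|left].
    have wv : w != v by rewrite eq_sym.
    by apply: colour_rank_eq; case: (pairs _ _ wv ewv (tops_active dw) (tops_active cv)).
  case: bE pv => ->; rewrite ?in_block ?in_coblock; last by rewrite !finset.in_set.
  - by rewrite !off_starE /= !xpair_eqE (negPf vw) /=; case: same => ->; rewrite ?andbF.
  - by rewrite !off_starE /= !xpair_eqE (negPf vw) /=; case: same => ->; rewrite ?andbF.
subst w; congr (_, _).
have bb : block v c = block v d.
  case: bE pv => -> //.
    by rewrite in_coblock xpair_eqE andbF off_starE eqxx.
  by rewrite finset.in_set finset.in_set /= e_irr.
have [cP _] := topsP cv; have [dP _] := topsP dw.
have [x xv xE] := colour_rank_hit cP; have [y yv yE] := colour_rank_hit dP.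
have neq z b : z \in off_star e v -> (z == (v, b)) = false.
  by move=> zv; apply: contraTF zv => /eqP->; rewrite off_starE eqxx.
have : (x \in block v c) = (x \in block v d) by rewrite bb.
have : (y \in block v c) = (y \in block v d) by rewrite bb.
rewrite !in_block xv yv !neq //= xE yE !ltnn => /negbT; rewrite -leqNgt => le1.
move=> /esym/negbT; rewrite -leqNgt => le2.
have : index c (enum (palette v)) = index d (enum (palette v)).
  by apply/eqP; rewrite eqn_leq le1 le2.
move=> /(congr1 (nth c (enum (palette v)))); rewrite !nth_index ?mem_enum //.
Qed.

Lemma collection_of_colouring (L : {set V}) :
  (\sum_(v in L) excess e (r v) v <= max_compatible e L)%N.
Proof.
pose K := [set p : V * T | p.2 \in (if p.1 \in L then tops p.1 else finset.set0)].
have KP p : p \in K -> p.1 \in L /\ p.2 \in tops p.1.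
  by rewrite finset.in_set; case: ifP; rewrite ?finset.in_set0.
pose C := [set block_partition p.1 p.2 | p in K].
have -> : (\sum_(v in L) excess e (r v) v = #|C|)%N.
  rewrite card_in_imset => [|[v c] [w d] /KP[_ cv] /KP[_ dw]]; last exact: block_partition_inj.
  rewrite /K (card_dependent_pairs (fun v => if v \in L then tops v else finset.set0)).
  rewrite big_mkcond /=; apply: eq_bigr => v _.
  by case: ifP; rewrite ?cards0 // card_tops.
apply: leq_bigmax_cond; apply/andP; split.
  apply/forallP=> PP; apply/implyP=> /imsetP[[v c] /KP[vL cv] ->].
  by apply/existsP; exists v; rewrite vL block_partition_based.
apply/forallP=> PP; apply/implyP=> /imsetP[[v c] /KP[_ cv] ->].
apply/forallP=> QQ; apply/implyP=> /imsetP[[w d] /KP[_ dw] ->].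
apply/implyP=> _; apply: block_compatible => //=.
have [vw|vw] := eqVneq (st e v) (st e w); first by left; apply: blocks_nested.
have [evw|evw] := boolP (e v w); first by right.
by left; apply: blocks_separated => //; apply: contraNneq vw => ->.
Qed.

End Blocks.

Theorem theorem4p28 (V : finType) (e : rel V)
  (e_sym : symmetric e) (e_irr : irreflexive e)
  (H : set (out (raag e))) (k : nat)
  (H_untwisted : (H `<=` untwisted e)%classic)
  (H_gen : exists2 S : set (out (raag e)),
     (S `<=` @out_class (raag e) @` is_whitehead e)%classic
     & H = generated S)
  (H_free : free_abelian_of_rank k H) :
  (k <= max_compatible e (principal e))%N.
Proof.
have [f [fM f_inj f_range]] := H_free; have [S SW HS] := H_gen.
have H_abelian g h : H g -> H h -> commute g h.
  rewrite -f_range => -[u _ <-] [w _ <-].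
  by rewrite /commute -!fM GRing.addrC.
apply: leq_trans (free_abelian_rank_le fM f_inj f_range SW HS) _.
have [T [r [r_coh r_principal le]]] :=
  make_principal e_sym e_irr (side_colour_coherent e_sym e_irr H_abelian).
apply: leq_trans le _.
apply: leq_trans (collection_of_colouring e_sym e_irr
  (star_colour_coherent e_sym r_coh) (@star_colour_st _ e _ r) _).
rewrite [leqRHS]big_mkcond; apply: leq_sum => v _; case: ifP => [_|vN].
  exact: star_colour_excess.
by rewrite excess_inactive //; apply: contraFN vN; apply: r_principal.
Qed.
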